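(* Let $(\mathfrak W,\mathfrak V)$ be an AVWC. 1. If $\mathfrak W$ is symmetrizable, then $C_{\mathrm S}(\mathfrak W,\mathfrak V)=0$. 2. If $\mathfrak W$ is non-symmetrizable, then $C_{\mathrm S}(\mathfrak W,\mathfrak V)=C^{\mathrm{mean}}_{\mathrm{S,ran}}(\mathfrak W,\mathfrak V)$.
   Context: All alphabets are finite; logs base 2; $C(\mathcal A,\mathcal B)$ denotes channels from $\mathcal A$ to $\mathcal B$. An AVWC $(\mathfrak W,\mathfrak V)$: alphabets $\mathcal X$ (input), $\mathcal Y$ (Bob), $\mathcal Z$ (Eve), finite state set $\mathcal S$, channels $W_s\in C(\mathcal X,\mathcal Y)$, $V_s\in C(\mathcal X,\mathcal Z)$; $W_{s^n}=W_{s_1}\otimes\cdots\otimes W_{s_n}$, $V_{s^n}$ likewise. $\mathfrak W=(W_s)_s$ is symmetrizable if there is $U\in C(\mathcal X,\mathcal S)$ with $\sum_su(s|x)w_s(y|x')=\sum_su(s|x')w_s(y|x)$ for all $x,x'\in\mathcal X$, $y\in\mathcal Y$. A common randomness assisted code of blocklength $n$: $K,\Gamma\in\mathbb N$, stochastic encoders $e^\gamma\in C([K],\mathcal X^n)$, sets $D^\gamma_k\subset\mathcal Y^n$ disjoint in $k$ for each $\gamma$; average error $1-\min_{s^n}\frac1{K\Gamma}\sum_{k,\gamma}\sum_{x^n}e^\gamma(x^n|k)w_{s^n}(D^\gamma_k|x^n)$. Random variables: message $\mathfrak K$ uniform on $[K]$, independent $\mathfrak\Gamma$ uniform on $[\Gamma]$,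 input $x^n\sim e^\gamma(\cdot|k)$, Eve's output $\mathfrak Z_{s^n}\sim V_{s^n}(\cdot|x^n)$. $C_{\mathrm S}(\mathfrak W,\mathfrak V)$ (uncorrelated coding secrecy capacity) is the supremum of $R$ such that there are such codes with $\Gamma_n=1$, error $\to0$, $\liminf\frac1n\log K_n=R$ and $\limsup_n\max_{s^n}I(\mathfrak K_n;\mathfrak Z_{s^n})=0$. $C^{\mathrm{mean}}_{\mathrm{S,ran}}(\mathfrak W,\mathfrak V)$ (correlated random coding mean secrecy capacity) is the supremum of $R$ such that there are such codes (arbitrary $\Gamma_n$) with error $\to0$, $\liminf\frac1n\log K_n=R$ and $\limsup_n\max_{s^n}I(\mathfrak K_n;\mathfrak Z_{s^n}|\mathfrak\Gamma_n)=0$. *)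

(* Defs.v *)
From HB Require Import structures.
From mathcomp Require Import all_boot all_order all_algebra.
From mathcomp Require Import all_classical all_reals all_analysis.
Set Implicit Arguments. Unset Strict Implicit. Unset Printing Implicit Defensive.
Import Order.TTheory GRing.Theory Num.Theory.
Import numFieldTopology.Exports numFieldNormedType.Exports.
Local Open Scope ring_scope.

Section AVWC.
Variable R : realType.

Definition log2 (x : R) : R := ln x / ln 2.

Definition is_channel (A B : finType) (W : A -> B -> R) : Prop :=
  forall a, (forall b, 0 <= W a b) /\ \sum_(b : B) W a b = 1.

Definition symmetrizable (X Y S : finType) (W : S -> X -> Y -> R) : Prop :=
  exists U : X -> S -> R, is_channel U /\
    forall (x x' : X) (y : Y),
      \sum_(s : S) U x s * W s x' y = \sum_(s : S) U x' s * W s x y.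

Definition prodch (X Y S : finType) (n : nat) (W : S -> X -> Y -> R)
  (sn : {ffun 'I_n -> S}) (xn : {ffun 'I_n -> X}) (yn : {ffun 'I_n -> Y}) : R :=
  \prod_(i < n) W (sn i) (xn i) (yn i).

(* common randomness assisted code of blocklength n (data) *)
Record code (X Y : finType) (n : nat) := Code {
  cK : nat;
  cG : nat;
  enc : 'I_cG -> 'I_cK -> {ffun 'I_n -> X} -> R;   (* e^gamma(x^n | k) *)
  dec : 'I_cG -> 'I_cK -> {set {ffun 'I_n -> Y}}
}.
Arguments cK {X Y n} c.
Arguments cG {X Y n} c.
Arguments enc {X Y n} c _ _ _.
Arguments dec {X Y n} c _ _.

Definition valid_code (X Y : finType) (n : nat) (c : code X Y n) : Prop :=
  [/\ (0 < cK c)%N, (0 < cG c)%N,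
      (forall g k, is_channel (fun (_ : unit) xn => enc c g k xn) ) &
      (forall g (k k' : 'I_(cK c)), k != k' -> [disjoint dec c g k & dec c g k'])].

Definition succ (X Y S : finType) (n : nat) (W : S -> X -> Y -> R)
  (c : code X Y n) (sn : {ffun 'I_n -> S}) : R :=
  ((cK c)%:R * (cG c)%:R)^-1 *
  \sum_(k < cK c) \sum_(g < cG c) \sum_(xn : {ffun 'I_n -> X})
     enc c g k xn * \sum_(yn in dec c g k) prodch W sn xn yn.

Definition avg_err (X Y S : finType) (n : nat) (W : S -> X -> Y -> R)
  (c : code X Y n) : R :=
  1 - \big[Num.min/1]_(sn : {ffun 'I_n -> S}) succ W c sn.

Definition joint (X Y Z S : finType) (n : nat) (V : S -> X -> Z -> R)
  (c : code X Y n) (sn : {ffun 'I_n -> S})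
  (g : 'I_(cG c)) (k : 'I_(cK c)) (zn : {ffun 'I_n -> Z}) : R :=
  ((cK c)%:R * (cG c)%:R)^-1 *
  \sum_(xn : {ffun 'I_n -> X}) enc c g k xn * prodch V sn xn zn.

Arguments joint {X Y Z S n} V c sn g k zn.

(* mutual information I(A;B) of a joint pmf p on A x B (0 log 0 = 0) *)
Definition mutinf (A B : finType) (p : A -> B -> R) : R :=
  \sum_(a : A) \sum_(b : B)
    (if 0 < p a b then
       p a b * log2 (p a b / ((\sum_(b' : B) p a b') * (\sum_(a' : A) p a' b)))
     else 0).

Definition cmutinf (C A B : finType) (p : C -> A -> B -> R) : R :=
  \sum_(c : C) \sum_(a : A) \sum_(b : B)
    (if 0 < p c a b then
       p c a b * log2 (p c a b * (\sum_(a' : A) \sum_(b' : B) p c a' b')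
                       / ((\sum_(b' : B) p c a b') * (\sum_(a' : A) p c a' b)))
     else 0).

Definition leak (X Y Z S : finType) (n : nat) (V : S -> X -> Z -> R)
  (c : code X Y n) (sn : {ffun 'I_n -> S}) : R :=
  mutinf (fun (k : 'I_(cK c)) (zn : {ffun 'I_n -> Z}) =>
            \sum_(g < cG c) joint V c sn g k zn).

Definition cleak (X Y Z S : finType) (n : nat) (V : S -> X -> Z -> R)
  (c : code X Y n) (sn : {ffun 'I_n -> S}) : R :=
  cmutinf (joint V c sn).

Definition max_leak (X Y Z S : finType) (n : nat) (V : S -> X -> Z -> R)
  (c : code X Y n) : R :=
  \big[Num.max/0]_(sn : {ffun 'I_n -> S}) leak V c sn.
Definition max_cleak (X Y Z S : finType) (n : nat) (V : S -> X -> Z -> R)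
  (c : code X Y n) : R :=
  \big[Num.max/0]_(sn : {ffun 'I_n -> S}) cleak V c sn.

Definition rate (X Y : finType) (n : nat) (c : code X Y n) : R :=
  log2 (cK c)%:R / n%:R.

Local Open Scope classical_set_scope.

Definition err_vanishes (X Y S : finType) (W : S -> X -> Y -> R)
  (c : forall n, code X Y n) : Prop :=
  (fun n => avg_err W (c n)) @ \oo --> (0:R).

Local Open Scope ereal_scope.

(* R is an achievable rate with uncorrelated codes (Gamma_n = 1) *)
Definition achievable_S (X Y Z S : finType) (W : S -> X -> Y -> R)
  (V : S -> X -> Z -> R) (r : R) : Prop :=
  exists c : forall n, code X Y n,
    [/\ (forall n, valid_code (c n)),
        (forall n, cG (c n) = 1%N),
        err_vanishes W c,
        limn_einf (fun n => (rate (c n))%:E) = r%:E &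
        limn_esup (fun n => (max_leak V (c n))%:E) = 0].

Definition achievable_Sran_mean (X Y Z S : finType) (W : S -> X -> Y -> R)
  (V : S -> X -> Z -> R) (r : R) : Prop :=
  exists c : forall n, code X Y n,
    [/\ (forall n, valid_code (c n)),
        err_vanishes W c,
        limn_einf (fun n => (rate (c n))%:E) = r%:E &
        limn_esup (fun n => (max_cleak V (c n))%:E) = 0].

Local Close Scope ereal_scope.

Definition C_S (X Y Z S : finType) (W : S -> X -> Y -> R)
  (V : S -> X -> Z -> R) : R :=
  sup [set r | achievable_S W V r].

Definition C_Sran_mean (X Y Z S : finType) (W : S -> X -> Y -> R)
  (V : S -> X -> Z -> R) : R :=
  sup [set r | achievable_Sran_mean W V r].

End AVWC.

(* Main.v *)
(** If [W] is symmetrizable, a jammer that sends an independent random codeword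
    through the symmetrizing channel makes the receiver unable to order the two
    codewords, so a code with at least two messages errs with probability at least
    1/4.

    If [W] is not symmetrizable, a correlated random code is first thinned out to
    [N^4] keys: by Chernoff bounds and a union bound over the state sequences, the
    error and the mean leakage are preserved. The key is then sent in clear over a
    short prefix, which costs no secrecy since, given the key, the prefix is
    independent of the message. Such a prefix code for polynomially many messages
    exists because a greedily chosen codebook has, for every state sequence, only
    boundedly many codewords correlated with the state and a rival codeword; for
    the others the receiver sees a joint type in which a rival looks like an input
    of the jammer, and by compactness of the set of would-be symmetrizers this
    cannot hold for two codewords at once. *)
Require Import Defs.
From HB Require Import structures.
From mathcomp Require Import all_boot all_order all_algebra.
From mathcomp Require Import all_classical all_reals all_analysis.
From mathcomp Require Import ring lra zify.
Set Implicit Arguments. Unset Strict Implicit. Unset Printing Implicit Defensive.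
Import Order.TTheory GRing.Theory Num.Theory.
Import numFieldTopology.Exports numFieldNormedType.Exports.
Local Open Scope ring_scope.

(** Union bounds over state sequences are costly: their number is exponential, and a deviation
    probability [exp (- c m)] with small [c] need not beat it. For the keys, this is paid for by
    their number. The information per key can reach [log K], of order [n], so deviations must be of
    order [1 / n]; with [L] keys the exponent is of order [L / n^2] and has to exceed a multiple of
    [n], which [L = N^4] ensures. For the prefix, some bad codewords are tolerated instead: with
    only polynomially many codewords, a constant number of simultaneous failures is already too
    unlikely for all state sequences and test words together. So only the average error of the
    prefix code is controlled, and it is joined to the average over keys by a bound linear in both.
    The prefix takes a fixed fraction [1 / p] of the length, which keeps [N^4] below [m^5]; the loss
    of rate disappears in the supremum. *)

(** * Eventual bounds and limits superior and inferior *)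

Section LimitsSupInf.
Local Open Scope classical_set_scope.
Local Open Scope ereal_scope.
Variable R : realType.
Implicit Types (u : nat -> \bar R) (a : \bar R).

Lemma limn_esup_lt_near u a : limn_esup u < a -> \forall n \near \oo, u n <= a.
Proof.
rewrite /limn_esup /limf_esup => /ereal_inf_lt[_ [A Aoo <-] supA].
apply: filterS Aoo => n An; apply: ltW; apply: le_lt_trans supA.
by apply: ereal_sup_ubound; exists n.
Qed.

Lemma near_limn_esup_le u a : (\forall n \near \oo, u n <= a) -> limn_esup u <= a.
Proof.
move=> ua; apply: (@le_trans _ _ (ereal_sup (u @` [set n | u n <= a]))).
  by apply: ereal_inf_lbound; exists [set n | u n <= a].
by apply: ge_ereal_sup => _ [n /= un <-].
Qed.

Lemma limn_einf_gt_near u a : a < limn_einf u -> \forall n \near \oo, a <= u n.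
Proof.
rewrite /limn_einf lteNr => /limn_esup_lt_near.
by apply: filterS => n; rewrite leeN2.
Qed.

Lemma near_limn_einf_ge u a : (\forall n \near \oo, a <= u n) -> a <= limn_einf u.
Proof.
move=> ua; rewrite /limn_einf leeNr; apply: near_limn_esup_le.
by apply: filterS ua => n; rewrite leeN2.
Qed.

Lemma near_limn_einf_le u a : (\forall n \near \oo, u n <= a) -> limn_einf u <= a.
Proof. by move=> /near_limn_esup_le; apply: le_trans; exact: limn_einf_sup. Qed.

(** Achievability asks for a real number as lower limit of the rates; the upper bound [b] only
    serves to exclude an infinite one. *)
Lemma limn_einf_fin (v : nat -> R) (a b : R) :
  (\forall n \near \oo, (a <= v n)%R) -> (\forall n \near \oo, (v n <= b)%R) ->
  exists2 r : R, limn_einf (fun n => (v n)%:E) = r%:E & (a <= r)%R.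
Proof.
move=> va vb.
have la : a%:E <= limn_einf (fun n => (v n)%:E).
  by apply: near_limn_einf_ge; apply: filterS va => n; rewrite lee_fin.
have lb : limn_einf (fun n => (v n)%:E) <= b%:E.
  by apply: near_limn_einf_le; apply: filterS vb => n; rewrite lee_fin.
case: (limn_einf _) la lb => [r| |] //=; rewrite ?lee_fin ?leye_eq ?leeNy_eq //.
by exists r.
Qed.

End LimitsSupInf.

(** * Chernoff bounds for independent coordinates *)

Section Chernoff.
Variable R : realType.

(** From [1 - z <= expR (- z)], since [(1 + z + 2 z^2) (1 - z) = 1 + z^2 (1 - 2 z)] is at least 1
    for [z <= 1/2]. *)
Lemma expR_le_quadratic (z : R) : `|z| <= 1 / 2 -> expR z <= 1 + z + 2 * z ^+ 2.
Proof.
move=> zle; have {zle} /andP[zl zu] : - (1 / 2) <= z <= 1 / 2 by rewrite -ler_norml.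
have h := expR_ge1Dx (- z).
have z1 : 0 < 1 - z by lra.
rewrite -[z in expR z]opprK expRN -[leRHS]invrK lef_pV2 ?posrE ?expR_gt0 //; last first.
  by rewrite invr_gt0; nra.
apply: le_trans h; rewrite invf_ple ?posrE; last 2 first.
- by nra.
- by lra.
rewrite invf_ple ?posrE //; last by nra.
rewrite -div1r ler_pdivrMr; last by nra.
nra.
Qed.

Lemma sum_prod_ffun (B : finType) m (F : 'I_m -> B -> R) :
  \sum_(y : {ffun 'I_m -> B}) \prod_(t < m) F t (y t) =
  \prod_(t < m) \sum_(b : B) F t b.
Proof. by rewrite bigA_distr_bigA. Qed.

(** Exponential moments. The law may vary with the coordinate, so that one bound covers random
    codewords, channel outputs under arbitrary states, and random keys. *)
Lemma chernoff_ffun (B : finType) m (p f : 'I_m -> B -> R) (e : R) :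
  (forall t b, 0 <= p t b) -> (forall t, \sum_b p t b = 1) ->
  (forall t, \sum_b p t b * f t b = 0) -> (forall t b, `|f t b| <= 1) ->
  0 <= e <= 1 ->
  \sum_(y : {ffun 'I_m -> B} | e * m%:R <= \sum_(t < m) f t (y t))
     \prod_(t < m) p t (y t) <= expR (- (e ^+ 2 / 8) * m%:R).
Proof.
(* [e / 4] minimises the exponent [2 th^2 - th e], with value [- e^2 / 8]. *)
move=> p0 p1 pf f1 /andP[e0 e1]; pose th := e / 4.
have th0 : 0 <= th by rewrite /th; lra.
have -> : - (e ^+ 2 / 8) * m%:R = - (th * e * m%:R) + 2 * th ^+ 2 * m%:R :> R.
  by rewrite /th; field.
rewrite expRD -ler_pdivrMl ?expR_gt0 // -expRN opprK.
apply: (@le_trans _ _ (\sum_(y : {ffun 'I_m -> B})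
    \prod_(t < m) (p t (y t) * expR (th * f t (y t))))).
  rewrite mulr_sumr big_mkcond; apply: ler_sum => y _; case: ifPn => [ey|_].
    rewrite big_split /= mulrC; apply: ler_wpM2l; first exact: prodr_ge0.
    rewrite -expR_sum ler_expR -mulr_sumr -mulrA; exact: ler_wpM2l.
  by apply: prodr_ge0 => t _; rewrite mulr_ge0 // expR_ge0.
rewrite (sum_prod_ffun (fun t b => p t b * expR (th * f t b))) mulrC expRM_natl -[X in _ ^+ X]card_ord -prodr_const.
apply: ler_prod => t _; apply/andP; split.
  by apply: sumr_ge0 => b _; rewrite mulr_ge0 // expR_ge0.
apply: (@le_trans _ _ (\sum_b (p t b + th * (p t b * f t b) + 2 * th ^+ 2 * p t b))).
  apply: ler_sum => b _.
  have thf : `|th * f t b| <= 1 / 2.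
    rewrite normrM (ger0_norm th0); have := f1 t b; have := normr_ge0 (f t b).
    by rewrite /th; nra.
  have /(ler_wpM2l (p0 t b)) := expR_le_quadratic thf.
  move=> /le_trans; apply.
  have : `|f t b| ^+ 2 <= 1 by rewrite expr_le1.
  rewrite real_normK ?num_real // => ff.
  have : th ^+ 2 * f t b ^+ 2 <= th ^+ 2 by rewrite ler_piMr // sqr_ge0.
  by have := p0 t b; move: (th ^+ 2 * f t b ^+ 2) (exprMn 2 th (f t b)) => w -> ; nra.
rewrite !big_split /= -!mulr_sumr pf p1 mulr0 addr0 mulr1.
exact: expR_ge1Dx.
Qed.

Lemma chernoff_ffun_abs (B : finType) m (p f : 'I_m -> B -> R) (e : R) :
  (forall t b, 0 <= p t b) -> (forall t, \sum_b p t b = 1) ->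
  (forall t, \sum_b p t b * f t b = 0) -> (forall t b, `|f t b| <= 1) ->
  0 <= e <= 1 ->
  \sum_(y : {ffun 'I_m -> B} | e * m%:R <= `|\sum_(t < m) f t (y t)|)
     \prod_(t < m) p t (y t) <= 2 * expR (- (e ^+ 2 / 8) * m%:R).
Proof.
move=> p0 p1 pf f1 e01.
have h1 := chernoff_ffun p0 p1 pf f1 e01.
have h2 : \sum_(y : {ffun 'I_m -> B} | e * m%:R <= \sum_(t < m) - f t (y t))
     \prod_(t < m) p t (y t) <= expR (- (e ^+ 2 / 8) * m%:R).
  apply: (@chernoff_ffun B m p (fun t b => - f t b)) => //.
    by move=> t; under eq_bigr do rewrite mulrN; rewrite sumrN pf oppr0.
  by move=> t b; rewrite normrN.
rewrite mulr_natl mulr2n; apply: le_trans (lerD h1 h2).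
rewrite !(big_mkcond (fun y => e * _ <= _)) /= -big_split /=.
apply: ler_sum => y _; have P0 : 0 <= \prod_(t < m) p t (y t) by apply: prodr_ge0.
rewrite ler_normr sumrN.
by case: (e * m%:R <= \sum_(t < m) f t (y t)); case: (e * m%:R <= - _) => /=; lra.
Qed.

End Chernoff.

(** * The log-sum inequality *)

Section LogSum.
Variable R : realType.

Lemma ln_ge_1subV (t : R) : 0 < t -> 1 - t^-1 <= ln t.
Proof.
move=> t0; have tV : 0 < t^-1 by rewrite invr_gt0.
have h : -1 < t^-1 - 1 by lra.
have := le_ln1Dx h; have -> : 1 + (t^-1 - 1) = t^-1 :> R by ring.
rewrite lnV ?posrE //; lra.
Qed.

(** A tangent bound, linear in [a] and [b] and hence summable. Taking for [c] the ratio of the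
    totals gives the log-sum inequality; [c = 1] gives nonnegativity of information. *)
Lemma mul_ln_div_ge (a b c : R) : 0 < a -> 0 < b -> 0 < c ->
  a * ln c + a - c * b <= a * ln (a / b).
Proof.
move=> a0 b0 c0.
have := @ln_ge_1subV (a / b / c); rewrite !divr_gt0 // => /(_ isT).
rewrite [ln (a / b / c)]ln_div ?posrE ?divr_gt0 // => /(ler_wpM2l (ltW a0)).
have -> : a * (1 - (a / b / c)^-1) = a - c * b :> R by field; rewrite !lt0r_neq0.
lra.
Qed.

Lemma log_sum (I : finType) (a b : I -> R) :
  (forall i, 0 <= a i) -> (forall i, 0 <= b i) -> (forall i, b i = 0 -> a i = 0) ->
  0 < \sum_i a i ->
  (\sum_i a i) * ln ((\sum_i a i) / (\sum_i b i)) <=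
  \sum_i (if 0 < a i then a i * ln (a i / b i) else 0).
Proof.
move=> a0 b0 ab A0; set A := \sum_i a i; set B := \sum_i b i.
have B0 : 0 < B.
  have : 0 <= B by apply: sumr_ge0.
  rewrite le_eqVlt => /orP[/eqP/esym /(psumr_eq0P (fun i _ => b0 i)) bz|//].
  by move: A0; rewrite big1 ?ltxx // => i _; apply: ab; apply: bz.
have c0 : 0 < A / B by rewrite divr_gt0.
apply: (@le_trans _ _ (\sum_i (a i * ln (A / B) + a i - A / B * b i))).
  rewrite !big_split /= sumrN -mulr_suml -mulr_sumr -/A -/B.
  by rewrite divfK ?lt0r_neq0 // addrK.
apply: ler_sum => i _; case: ifPn => [ai|].
  apply: mul_ln_div_ge => //; rewrite lt_def b0 andbT.
  by apply/eqP => /ab ai0; move: ai; rewrite ai0 ltxx.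
rewrite -leNgt => ai; have -> : a i = 0 by apply/eqP; rewrite eq_le ai a0.
by rewrite mul0r !add0r oppr_le0 mulr_ge0 // ltW.
Qed.

End LogSum.

(** * A quantitative form of non-symmetrizability *)

Section SymmetrizabilityGap.
Variables (R : realType) (X Y S : finType) (W : S -> X -> Y -> R).
Hypothesis hW : forall s, is_channel (W s).

Definition sym_defect (U : X -> S -> R) (q : X * X * Y) : R :=
  \sum_s U q.1.2 s * W s q.1.1 q.2 - \sum_s U q.1.1 s * W s q.1.2 q.2.

(* [U] is a law on [X * S] rather than a channel: summing over the output shows
   that a vanishing defect already forces a uniform [X]-marginal. *)
Lemma defect0_symmetrizable (x0 : X) (U : X -> S -> R) :
  (forall x s, 0 <= U x s) -> \sum_x \sum_s U x s = 1 ->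
  (forall q, sym_defect U q = 0) -> symmetrizable W.
Proof.
move=> U0 U1 Ud.
have rows x x' : \sum_s U x s = \sum_s U x' s.
  have E a b : \sum_y \sum_s U a s * W s b y = \sum_s U a s.
    rewrite exchange_big; apply: eq_bigr => s _.
    by rewrite -mulr_sumr (hW s b).2 mulr1.
  rewrite -(E x x') -(E x' x); apply: eq_bigr => y _.
  by apply/eqP; rewrite -subr_eq0; apply/eqP; exact: (Ud (x', x, y)).
have cX : (#|X|%:R : R) != 0.
  by rewrite pnatr_eq0 -lt0n; apply/card_gt0P; exists x0.
have row1 x : #|X|%:R * \sum_s U x s = 1.
  rewrite mulr_natl -sumr_const -[RHS]U1; apply: eq_bigr => x' _; exact: rows.
exists (fun x s => #|X|%:R * U x s); split.
  move=> x; split; first by move=> s; rewrite mulr_ge0 // ler0n.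
  by rewrite -mulr_sumr row1.
move=> x x' y; under eq_bigr do rewrite -mulrA.
under [RHS]eq_bigr do rewrite -mulrA.
rewrite -!mulr_sumr; congr (_ * _).
by apply/eqP; rewrite -subr_eq0; apply/eqP; exact: (Ud (x', x, y)).
Qed.

Local Open Scope classical_set_scope.

(** The sum of all [|sym_defect|] is continuous on the compact simplex of laws on [X * S] and
    attains its minimum there, which is positive by [defect0_symmetrizable]. Some triple carries at
    least an average share of it. *)
Lemma nonsymmetrizable_gap (x0 : X) : ~ symmetrizable W ->
  exists2 xi : R, 0 < xi & forall U : X -> S -> R,
    (forall x s, 0 <= U x s) -> \sum_x \sum_s U x s = 1 ->
    exists q, xi <= `|sym_defect U q|.
Proof.
move=> nsym; pose k := #|{: X * S}|.
pose mx (u : 'rV[R]_k) x s := u ord0 (enum_rank (x, s)).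
pose A := [set u : 'rV[R]_k | forall i, (`[0, 1]%classic : set R) (u ord0 i)] `&`
          [set u | \sum_x \sum_s mx u x s = 1].
have cmx x s : continuous (fun u => mx u x s) by move=> u; exact: coord_continuous.
have csum (I : finType) (F : I -> 'rV[R]_k -> R) :
    (forall i, continuous (F i)) -> continuous (fun u => \sum_i F i u).
  move=> cF; apply: (@continuous_big R I +%R 0 xpredT) => [|i _]; last exact: cF.
  exact: add_continuous.
have cA : compact A.
  apply: compact_closedI; first by apply: (@rV_compact R k (fun=> `[0, 1]%classic)) => i; exact: segment_compact.
  apply: (@closed_comp _ _ (fun u => \sum_x \sum_s mx u x s) [set 1]); last exact: closed_eq.
  by move=> u _; apply: (csum _ _) => x; apply: (csum _ _) => s; exact: cmx.
pose g : 'rV[R]_k -> R := fun u => \sum_q `|sym_defect (mx u) q|.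
have cW z z' y : continuous (fun u => \sum_s mx u z s * W s z' y).
  apply: (csum _ _) => s u; exact: (cvgM (cmx z s u) (cvg_cst (W s z' y))).
have cg : continuous g.
  apply: (csum _ _) => q u.
  have cd := cvgB (cW q.1.2 q.1.1 q.2 u) (cW q.1.1 q.1.2 q.2 u).
  exact: (cvg_norm (cd _)).
have toA U : (forall x s, 0 <= U x s) -> \sum_x \sum_s U x s = 1 ->
    exists2 u, A u & mx u = U.
  move=> U0 U1; pose u : 'rV[R]_k := \row_i U (enum_val i).1 (enum_val i).2.
  have muU : mx u = U by apply/funext => x; apply/funext => s; rewrite /mx mxE enum_rankK.
  exists u => //; split; last by rewrite /= muU.
  move=> i /=; rewrite mxE in_itv /= U0 /= -[leRHS]U1.
  rewrite (bigD1 (enum_val i).1) //= (bigD1 (enum_val i).2) //= -addrA lerDl.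
  by rewrite addr_ge0 // sumr_ge0 // => x _; rewrite sumr_ge0.
have [A0|] := pselect (A !=set0); last first.
  (* An empty simplex leaves no admissible [U], so any positive [xi] works. *)
  by move=> A0; exists 1 => // U U0 U1; case: A0; have [u Au _] := toA U U0 U1; exists u.
have [u /set_mem Au umin] := EVT_min_rV A0 cA (continuous_subspaceT cg).
have gu0 : 0 < g u.
  rewrite lt_def sumr_ge0 ?andbT //; apply/eqP => g0; apply: nsym.
  case: Au => Au1 Au2; apply: (@defect0_symmetrizable x0 (mx u)) => //.
    by move=> x s; have := Au1 (enum_rank (x, s)); rewrite /= in_itv /= => /andP[].
  move=> q; apply/eqP; rewrite -normr_eq0; apply/eqP.
  exact: (psumr_eq0P (fun i _ => normr_ge0 (sym_defect (mx u) i)) g0).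
exists (g u / #|{: X * X * Y}|.+1%:R) => [|U U0 U1]; first by rewrite divr_gt0.
have [v Av vU] := toA U U0 U1.
apply: contrapT => /forallNP none; have := umin v (mem_set Av); apply/negP; rewrite -ltNge.
apply: (@le_lt_trans _ _ (\sum_(q : X * X * Y) (g u / #|{: X * X * Y}|.+1%:R))).
  rewrite /g vU; apply: ler_sum => q _; apply: ltW; rewrite ltNge; apply/negP; exact: none.
rewrite sumr_const -[ltLHS]mulr_natr mulrAC ltr_pdivrMr // ltr_pM2l // ltr_nat.
exact: ltnSn.
Qed.

End SymmetrizabilityGap.

(** * Greedy choice of a codebook *)

Section GreedyCodebook.
Variable R : realType.

Lemma exists_le_average (T : finType) (F : T -> R) (v : R) (t0 : T) :
  \sum_t F t <= #|T|%:R * v -> exists t, F t <= v.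
Proof.
move=> Fv; apply: contrapT => /forallNP none; move: Fv; apply/negP; rewrite -ltNge.
rewrite mulr_natl -sumr_const; apply: ltr_sum; first by apply/hasP; exists t0; rewrite ?mem_index_enum.
by move=> t _; rewrite ltNge; apply/negP; exact: none.
Qed.

Variables (T Q : finType) (bad : Q -> T -> T -> bool) (q : R).
Hypothesis q0 : 0 <= q.
Hypothesis bad_card : forall s x', \sum_x (bad s x x')%:R <= q * #|T|%:R.

(** Only earlier codewords are compared with [c k]: they are fixed when it is chosen, so a uniform
    choice fails with probability at most [(k + 1) q]. The additional word [x'] later plays the part
    of an arbitrary rival. *)
Definition late_bad (c : nat -> T) s x' k : bool :=
  bad s (c k) x' || [exists i : 'I_k, bad s (c k) (c i)].

(* The codewords are chosen one by one so that the potential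
   [sum_(s, x') (1 + th) ^ #{k | late_bad c s x' k}] grows at most as fast as it
   does on average; a large [th] then bounds the count for every [s] and [x']. *)
Lemma greedy_codebook (t0 : T) (th : R) (M N : nat) : 0 <= th -> (N <= M)%N ->
  exists c : nat -> T,
    \sum_s \sum_x' (1 + th) ^+ (\sum_(k < N) late_bad c s x' k) <=
    (1 + th * (M%:R * q)) ^+ N * (#|Q|%:R * #|T|%:R).
Proof.
move=> th0; elim: N => [|N IH] NM.
  exists (fun=> t0); rewrite expr0 mul1r.
  under eq_bigr do under eq_bigr do rewrite big_ord0 expr0.
  by rewrite !sumr_const -[leLHS]mulr_natl.
have [c Hc] := IH (ltnW NM).
pose c' x k := if k == N then x else c k.
(* Averaged over [x], each term of the potential grows by a factor of at most [1 + th (N + 1) q],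
   and [N < M]. *)
have [x Hx] : exists x, \sum_s \sum_x' (1 + th) ^+ (\sum_(k < N.+1) late_bad (c' x) s x' k)
    <= (1 + th * (M%:R * q)) * (\sum_s \sum_x' (1 + th) ^+ (\sum_(k < N) late_bad c s x' k)).
  apply: (exists_le_average t0).
  rewrite exchange_big /= mulr_sumr mulr_sumr; apply: ler_sum => s _.
  rewrite exchange_big /= mulr_sumr mulr_sumr; apply: ler_sum => x' _.
  set n := (\sum_(k < N) late_bad c s x' k)%N.
  have E x : (1 + th) ^+ (\sum_(k < N.+1) late_bad (c' x) s x' k) <=
      (1 + th) ^+ n * (1 + th * ((bad s x x')%:R + \sum_(i < N) (bad s x (c i))%:R)).
    rewrite big_ord_recr /= exprD; set n' := (\sum_(i < N) _)%N.
    have -> : n' = n.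
      apply: eq_bigr => k _; rewrite /late_bad /c' (ltn_eqF (ltn_ord k)); congr (nat_of_bool (_ || _)).
      by apply: eq_existsb => i; rewrite (ltn_eqF (ltn_trans (ltn_ord i) (ltn_ord k))).
    apply: ler_wpM2l; first by rewrite exprn_ge0 // addr_ge0.
    have -> : late_bad (c' x) s x' N = bad s x x' || [exists i : 'I_N, bad s x (c i)].
      rewrite /late_bad /c' eqxx; congr (_ || _).
      by apply: eq_existsb => i; rewrite (ltn_eqF (ltn_ord i)).
    have S0 : 0 <= \sum_(i < N) (bad s x (c i))%:R :> R by apply: sumr_ge0.
    case: (boolP (bad s x x')) => [_|_] /=; first by rewrite expr1 lerD2l ler_peMr // lerDl.
    case: existsP => [[i bi]|_] /=; last by rewrite expr0 lerDl mulr_ge0 // add0r.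
    rewrite expr1 lerD2l ler_peMr // add0r (bigD1 i) //= bi lerDl.
    by apply: sumr_ge0.
  apply: le_trans (ler_sum _ (fun x _ => E x)) _.
  rewrite -mulr_sumr mulrCA mulrA [leRHS]mulrC; apply: ler_wpM2l; first by rewrite exprn_ge0 // addr_ge0.
  rewrite big_split /= sumr_const -mulr_sumr big_split /= exchange_big /=.
  rewrite mulrDl mul1r lerD2l -mulrA; apply: ler_wpM2l => //.
  apply: (@le_trans _ _ (q * #|T|%:R + \sum_(i < N) q * #|T|%:R)).
    by apply: lerD => //; apply: ler_sum => i _.
  rewrite sumr_const card_ord -mulrS -[leLHS]mulr_natl mulrA.
  by apply: ler_wpM2r => //; apply: ler_wpM2r => //; rewrite ler_nat.
exists (c' x); apply: le_trans Hx _; rewrite exprS -mulrA; apply: ler_wpM2l => //.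
by rewrite addr_ge0 // mulr_ge0 // mulr_ge0.
Qed.

End GreedyCodebook.

(** * Memoryless channels *)

Section ProductChannel.
Variables (R : realType) (X Y S : finType) (W : S -> X -> Y -> R).
Hypothesis hW : forall s, is_channel (W s).

Lemma channel_ge0 r a b : 0 <= W r a b. Proof. exact: (hW r a).1. Qed.

Lemma channel_le1 r a b : W r a b <= 1.
Proof.
rewrite -(hW r a).2 (bigD1 b) //= lerDl; apply: sumr_ge0 => b' _.
exact: channel_ge0.
Qed.

Lemma prodch_ge0 n (s : {ffun 'I_n -> S}) x y : 0 <= prodch W s x y.
Proof. by apply: prodr_ge0 => t _; exact: (hW _ _).1. Qed.

Lemma prodch_sum1 n (s : {ffun 'I_n -> S}) x : \sum_y prodch W s x y = 1.
Proof.
rewrite /prodch (sum_prod_ffun (fun t => W (s t) (x t))) big1 // => t _.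
exact: (hW _ _).2.
Qed.

Lemma prodch_sum_le1 n (s : {ffun 'I_n -> S}) x (D : {set {ffun 'I_n -> Y}}) :
  \sum_(y in D) prodch W s x y <= 1.
Proof.
rewrite -(prodch_sum1 s x) [leRHS](bigID (fun y => y \in D)) /= lerDl.
by apply: sumr_ge0 => y _; exact: prodch_ge0.
Qed.

End ProductChannel.

(** * Correlation of codewords with a state sequence and a rival *)

Section Codewords.
Variables (R : realType) (X Y S : finType) (W : S -> X -> Y -> R).
Hypothesis hW : forall s, is_channel (W s).
Variables (x0 : X) (m : nat).
Local Notation Xm := {ffun 'I_m -> X}.
Local Notation Sm := {ffun 'I_m -> S}.
Local Notation u := ((#|X|%:R : R)^-1).
Implicit Types (s : Sm) (x : Xm) (a c : X) (b : Y).

Lemma cardX_gt0 : 0 < #|X|%:R :> R.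
Proof. by rewrite ltr0n; apply/card_gt0P; exists x0. Qed.

Lemma invX_le1 : u <= 1.
Proof. by rewrite invf_le1 ?cardX_gt0 // ler1n; apply/card_gt0P; exists x0. Qed.

(* Empirical covariance between the event [x_t = a] and the weights
   [1[x'_t = a'] W_(s_t)(b|c)], with [x_t] compared to the uniform law. *)
Definition dev s x x' a a' c b : R :=
  \sum_(t < m) ((x t == a)%:R - u) * ((x' t == a')%:R * W (s t) c b).

Definition correlated (e : R) s x x' : bool :=
  [exists q : X * X * X * Y, e * m%:R <= `|dev s x x' q.1.1.1 q.1.1.2 q.1.2 q.2|].

(** For a uniform word [x] the letters are independent and [dev] is a centred sum; the Chernoff
    bound is applied to each quadruple of letters. *)
Lemma correlated_card (e : R) s x' : 0 <= e <= 1 ->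
  \sum_x (correlated e s x x')%:R <=
  #|{: X * X * X * Y}|%:R * (2 * expR (- (e ^+ 2 / 8) * m%:R)) * #|{: Xm}|%:R.
Proof.
move=> e01.
pose P (q : X * X * X * Y) x := e * m%:R <= `|dev s x x' q.1.1.1 q.1.1.2 q.1.2 q.2|.
apply: (@le_trans _ _ (\sum_(x : Xm) \sum_q (P q x)%:R)).
  apply: ler_sum => x _; rewrite /correlated; case: existsP => [[q Pq]|_].
    by rewrite (bigD1 q) //= /P Pq lerDl; apply: sumr_ge0.
  by apply: sumr_ge0.
rewrite exchange_big /= -mulrA mulr_natl -sumr_const; apply: ler_sum => -[[[a a'] c] b] _.
have u0 : 0 < u by rewrite invr_gt0 cardX_gt0.
have uX : u * #|X|%:R = 1 by rewrite mulVf // lt0r_neq0 // cardX_gt0.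
have cT : #|{: Xm}|%:R = #|X|%:R ^+ m :> R by rewrite card_ffun card_ord natrX.
have : \sum_(x : Xm | P (a, a', c, b) x) \prod_(t < m) u <=
    2 * expR (- (e ^+ 2 / 8) * m%:R).
  apply: (@chernoff_ffun_abs R X m (fun _ _ => u)
    (fun t d => ((d == a)%:R - u) * ((x' t == a')%:R * W (s t) c b))) => //.
  - by move=> _; rewrite sumr_const -[LHS]mulr_natr.
  - move=> t; rewrite -mulr_sumr -mulr_suml big_split /= sumr_const.
    rewrite (bigD1 a) //= eqxx big1 => [|d /negbTE -> //].
    by rewrite addr0 -[(- u) *+ _]mulr_natr mulNr uX subrr mul0r mulr0.
  - move=> t d; rewrite !normrM -[leRHS]mulr1; apply: ler_pM => //.
      move: invX_le1 u0; move: u => v v1 v0.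
      by case: (d == a) => /=; rewrite ler_norml; apply/andP; split; lra.
    rewrite -[leRHS]mulr1; apply: ler_pM => //; first by case: (_ == _); rewrite ?normr1 ?normr0.
    by rewrite ger0_norm ?(channel_le1 hW) // (channel_ge0 hW).
rewrite prodr_const card_ord cT => H; rewrite -ler_pdivrMr ?exprn_gt0 ?cardX_gt0 //.
apply: le_trans H; rewrite mulr_suml [leRHS]big_mkcond /=; apply: ler_sum => x _.
by case: ifP => //= _; rewrite ?mul0r // mul1r exprVn.
Qed.

(** [dev] is symmetric in its two words up to [u] times the deviation of each single word against
    [s]. Summing over the letters of [x1] bounds these by [#|X| e m], and [u] cancels [#|X|]: three
    errors [e m] in all. *)
Lemma not_correlated_swap (e : R) s x x' x1 :
  ~~ correlated e s x' x -> ~~ correlated e s x x1 -> ~~ correlated e s x' x1 ->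
  forall a a' c b, `|dev s x x' a a' c b| <= 3 * e * m%:R.
Proof.
have le z z' a a' c b : ~~ correlated e s z z' -> `|dev s z z' a a' c b| <= e * m%:R.
  by move=> /existsPn /(_ (a, a', c, b)); rewrite -ltNge => /ltW.
pose dev1 z a c b := \sum_(t < m) ((z t == a)%:R - u) * W (s t) c b.
have le1 z a c b : ~~ correlated e s z x1 -> u * `|dev1 z a c b| <= e * m%:R.
  move=> nc; rewrite mulrC ler_pdivrMr ?cardX_gt0 //.
  have -> : dev1 z a c b = \sum_a' dev s z x1 a a' c b.
    rewrite exchange_big; apply: eq_bigr => t _; rewrite -mulr_sumr -mulr_suml; congr (_ * _).
    by rewrite (bigD1 (x1 t)) //= eqxx big1 ?addr0 ?mul1r // => d /negbTE; rewrite eq_sym => ->.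
  apply: le_trans (ler_norm_sum _ _ _) _; rewrite [leRHS]mulr_natr -sumr_const.
  by apply: ler_sum => a' _; exact: le.
move=> n1 n2 n3 a a' c b.
have -> : dev s x x' a a' c b = dev s x' x a' a c b + u * dev1 x a c b - u * dev1 x' a' c b.
  rewrite /dev /dev1 !mulr_sumr -!big_split /= -sumrN -big_split /=.
  by apply: eq_bigr => t _; ring.
have l1 := le _ _ a' a c b n1.
have := le1 _ a c b n2; have := le1 _ a' c b n3.
have u0 : 0 <= u by rewrite invr_ge0 ltW // cardX_gt0.
have uE z d : u * `|dev1 z d c b| = `|u * dev1 z d c b| by rewrite normrM (ger0_norm u0).
rewrite !uE => l2 l3; apply: le_trans (ler_normB _ _) _.
have := ler_normD (dev s x' x a' a c b) (u * dev1 x a c b); lra.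
Qed.

End Codewords.

(** * The decoder and its error *)

Section Decoder.
Variables (R : realType) (X Y S : finType) (W : S -> X -> Y -> R).
Hypothesis hW : forall s, is_channel (W s).
Variables (x0 : X) (m : nat).
Local Notation Xm := {ffun 'I_m -> X}.
Local Notation Ym := {ffun 'I_m -> Y}.
Local Notation Sm := {ffun 'I_m -> S}.
Local Notation u := ((#|X|%:R : R)^-1).
Implicit Types (s : Sm) (x : Xm) (y : Ym) (a : X) (b : Y).

Definition independent_of (e : R) s x x' : bool :=
  [forall q : X * X * X * Y, `|dev W s x x' q.1.1.1 q.1.1.2 q.1.2 q.2| <= e * m%:R].

Definition misleading (e : R) (c : nat -> Xm) N s : {set 'I_N} :=
  [set i : 'I_N | [exists j : 'I_N, (j != i) && ~~ independent_of e s (c i) (c j)]].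

(* A pair [i < j] is harmless when both [x_i] and [x_j] are uncorrelated with [s]
   and [x_j] with [(x_i, s)]; the few remaining [j] each spoil few [i]. *)
Lemma misleading_card (e : R) (c : nat -> Xm) N (T0 : nat) : 0 <= e ->
  (forall s x', (#|[set i : 'I_N | late_bad (correlated W e) c s x' i]| <= T0)%N) ->
  forall s, (#|misleading (3 * e) c N s| <= T0 + T0 * T0)%N.
Proof.
move=> e0 late s; pose z : Xm := [ffun=> x0].
pose B x' := [set i : 'I_N | late_bad (correlated W e) c s x' i].
have ncle x x' : ~~ correlated W e s x x' -> independent_of (3 * e) s x x'.
  move=> /existsPn nc; apply/forallP => q; apply: (@le_trans _ _ (e * m%:R)).
    by apply: ltW; rewrite ltNge nc.
  by apply: ler_wpM2r => //; lra.
(* If [i] is outside [B z], only a later [j] can spoil it. Such a [j] lies in [B z], and [i] lies in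
   [B (c j)] because [c j] may be taken as the additional word. *)
have sub : misleading (3 * e) c N s \subset B z :|: \bigcup_(j in B z) B (c j).
  apply/fintype.subsetP => i; rewrite inE => /existsP[j /andP[ji nind]].
  rewrite inE; have [//|iB /=] := boolP (i \in B z).
  have corr : correlated W e s (c i) (c j) by apply: contraR nind => /ncle.
  have [lt_ji|lt_ij|eq_ji] := ltngtP (j : nat) i; last by move/val_inj: eq_ji ji => ->; rewrite eqxx.
    case/negP: iB; rewrite inE /late_bad; apply/orP; right.
    by apply/existsP; exists (Ordinal lt_ji).
  apply/finset.bigcupP; exists j; last by rewrite inE /late_bad corr.
  apply: contraR nind => jB; apply/forallP => q.
  move: iB jB; rewrite !inE /late_bad !negb_or => /andP[ci _] /andP[cj /existsPn cij].
  exact: (not_correlated_swap x0 (cij (Ordinal lt_ij)) ci cj).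
apply: leq_trans (subset_leq_card sub) _; apply: leq_trans (leq_card_setU _ _) _.
apply: leq_add; first exact: late.
apply: leq_trans (_ : \sum_(j in B z) T0 <= _)%N; last first.
  by rewrite sum_nat_const leq_mul2r late orbT.
elim/big_rec2: _ => [|j k A _ Ak]; first by rewrite cards0.
by apply: leq_trans (leq_card_setU _ _) _; rewrite leq_add // late.
Qed.

Definition emp x x' y a a' b : R :=
  \sum_(t < m) (x t == a)%:R * ((x' t == a')%:R * (y t == b)%:R).

(** The value of [emp] to be expected when [x] is uniform, independent of [x'] and [s], and [y] is
    its output under [s]. *)
Definition jam_mean s x' a a' b : R := u * \sum_(t < m) (x' t == a')%:R * W (s t) a b.

(** [x] accounts for [y] against the rival [x']: for some state sequence, [x'] looks like a word
    known to the jammer and independent of the input. *)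
Definition compat (e : R) x x' y : bool :=
  [exists s, [forall q : X * X * Y,
    `|emp x x' y q.1.1 q.1.2 q.2 - jam_mean s x' q.1.1 q.1.2 q.2| <= e * m%:R]].

(* If [x] and [x'] both explain [y], the joint types of [(x', s1)] and [(x, s2)]
   average to an approximate symmetrizer. *)
Lemma compat_asym (e xi : R) x x' y : (0 < m)%N -> 2 * e < u * xi ->
  (forall U : X -> S -> R, (forall a r, 0 <= U a r) -> \sum_a \sum_r U a r = 1 ->
    exists q, xi <= `|sym_defect W U q|) ->
  compat e x x' y -> ~~ compat e x' x y.
Proof.
move=> m0 exi gap /existsP[s1 /forallP h1]; apply/negP => /existsP[s2 /forallP h2].
have m0R : 0 < m%:R :> R by rewrite ltr0n.
pose J x s a r : R := m%:R^-1 * \sum_(t < m) (x t == a)%:R * (s t == r)%:R.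
have J0 z s a r : 0 <= J z s a r.
  by rewrite mulr_ge0 ?invr_ge0 ?ler0n // sumr_ge0 // => t _; rewrite mulr_ge0 // ler0n.
have Jout z s a' a b : \sum_r J z s a' r * W r a b =
    m%:R^-1 * \sum_(t < m) (z t == a')%:R * W (s t) a b.
  under eq_bigr do rewrite -mulrA mulr_suml.
  rewrite -mulr_sumr exchange_big; congr (_ * _); apply: eq_bigr => t _.
  rewrite (bigD1 (s t)) //= eqxx mulr1 big1 ?addr0 // => r /negbTE; rewrite eq_sym => ->.
  by rewrite mulr0 mul0r.
have J1 z s : \sum_a \sum_r J z s a r = 1.
  under eq_bigr do rewrite -mulr_sumr exchange_big.
  rewrite -mulr_sumr exchange_big /= (eq_bigr (fun=> 1)) => [|t _].
    by rewrite sumr_const card_ord mulVf // lt0r_neq0.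
  rewrite (bigD1 (z t)) //= (bigD1 (s t)) //= !eqxx mulr1.
  rewrite big1 => [|r /negbTE]; last by rewrite eq_sym => ->; rewrite mulr0.
  rewrite big1 ?addr0 // => a /negbTE az; rewrite big1 // => r _.
  by rewrite eq_sym az mul0r.
have [||[[a a'] b]] := gap (fun a r => (J x' s1 a r + J x s2 a r) / 2).
- by move=> a r; rewrite divr_ge0 // addr_ge0.
- under eq_bigr do rewrite -mulr_suml big_split /=.
  by rewrite -mulr_suml big_split /= !J1 divff // pnatr_eq0.
apply/negP; rewrite -ltNge /sym_defect /=.
have E c c' : \sum_r (J x' s1 c' r + J x s2 c' r) / 2 * W r c b =
   (\sum_r J x' s1 c' r * W r c b + \sum_r J x s2 c' r * W r c b) / 2.
  by rewrite -big_split mulr_suml; apply: eq_bigr => r _ /=; ring.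
rewrite !E !Jout.
(* Both jammer means are within [e m] of the same joint type of [(x, x', y)]; division by [u m]
   turns this into less than [xi]. *)
have close c c' : `|m%:R^-1 * \sum_(t < m) (x' t == c')%:R * W (s1 t) c b -
    m%:R^-1 * \sum_(t < m) (x t == c)%:R * W (s2 t) c' b| < xi.
  have := h1 (c, c', b); have := h2 (c', c, b) => /= k2 k1.
  have sw : emp x' x y c' c b = emp x x' y c c' b by apply: eq_bigr => t _; ring.
  rewrite -mulrBr normrM ger0_norm ?invr_ge0 ?ler0n // mulrC ltr_pdivrMr //.
  have u0 : 0 < u by rewrite invr_gt0 (cardX_gt0 R x0).
  rewrite -(ltr_pM2l u0); apply: (@le_lt_trans _ _ (2 * e * m%:R)); last first.
    by rewrite mulrA ltr_pM2r.
  rewrite -[X in X * `|_|](ger0_norm (ltW u0)) -normrM mulrBr.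
  rewrite -/(jam_mean s1 x' c c' b) -/(jam_mean s2 x c' c b).
  move: k1 k2; rewrite sw [`|emp _ _ _ _ _ _ - jam_mean s1 _ _ _ _|]distrC => k1 k2.
  have := ler_distD (emp x x' y c c' b) (jam_mean s1 x' c c' b) (jam_mean s2 x c' c b).
  by move: k1 k2; lra.
(* The defect of the averaged law is half the difference of two such quantities. *)
have := close a a'; have := close a' a; move: (m%:R^-1 * _) (m%:R^-1 * _) => v1 v2.
move: (m%:R^-1 * _) (m%:R^-1 * _) => v3 v4; rewrite !ltr_norml => /andP[? ?] /andP[? ?].
by apply/andP; split; lra.
Qed.

(* Decode [i] when every rival [j] can be explained away as the jammer's input. *)
Definition decset (e : R) (c : nat -> Xm) N (i : 'I_N) : {set Ym} :=
  [set y | [forall j : 'I_N, (j != i) ==> compat e (c i) (c j) y]].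

(** The true state sequence witnesses [compat]: the joint type with a rival stays within [e m] of
    its mean, up to the Chernoff probability, and that mean is within [3 e m] of [jam_mean] as [i]
    is not misleading. The factors count rivals and triples of letters. *)
Lemma decset_fail (e : R) (c : nat -> Xm) N s (i : 'I_N) : 0 <= e <= 1 ->
  i \notin misleading (3 * e) c N s ->
  \sum_(y | y \notin decset (4 * e) c i) prodch W s (c i) y <=
  N%:R * (#|{: X * X * Y}|%:R * (2 * expR (- (e ^+ 2 / 8) * m%:R))).
Proof.
move=> e01 good.
pose d x' q y := emp (c i) x' y q.1.1 q.1.2 q.2 -
  \sum_(t < m) (c i t == q.1.1)%:R * ((x' t == q.1.2)%:R * W (s t) q.1.1 q.2).
have P0 y : 0 <= prodch W s (c i) y by exact: prodch_ge0.
have bound x' q : \sum_(y | e * m%:R <= `|d x' q y|) prodch W s (c i) y <=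
    2 * expR (- (e ^+ 2 / 8) * m%:R).
  case: q => [[a a'] b].
  have -> : \sum_(y | e * m%:R <= `|d x' (a, a', b) y|) prodch W s (c i) y =
     \sum_(y : Ym | e * m%:R <= `|\sum_(t < m) (c i t == a)%:R * ((x' t == a')%:R *
        ((y t == b)%:R - W (s t) a b))|) \prod_(t < m) W (s t) (c i t) (y t).
    apply: eq_bigl => y; congr (_ <= `|_|); rewrite /d /emp -sumrB.
    by apply: eq_bigr => t _ /=; ring.
  apply: (@chernoff_ffun_abs R Y m (fun t => W (s t) (c i t)) (fun t b' =>
     (c i t == a)%:R * ((x' t == a')%:R * ((b' == b)%:R - W (s t) a b)))) => //.
  - by move=> t b'; exact: channel_ge0.
  - by move=> t; exact: (hW _ _).2.
  - move=> t; have [->|_] := eqVneq (c i t) a; last by apply: big1 => b' _; rewrite mul0r mulr0.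
    under eq_bigr do rewrite mul1r mulrCA mulrBr.
    rewrite -mulr_sumr sumrB -mulr_suml (hW _ _).2 mul1r (bigD1 b) //= eqxx mulr1.
    by rewrite big1 ?addr0 ?subrr ?mulr0 // => b' /negbTE ->; rewrite mulr0.
  - move=> t b'; have [W0 W1] := (channel_ge0 hW (s t) a b, channel_le1 hW (s t) a b).
    have h : `|(b' == b)%:R - W (s t) a b| <= 1.
      by case: (b' == b) => /=; rewrite ler_norml; apply/andP; split; lra.
    case: (c i t == a); case: (x' t == a') => /=; rewrite ?(mul1r, mul0r, normr0) //.
apply: (@le_trans _ _ (\sum_(j < N) \sum_q \sum_(y | e * m%:R <= `|d (c j) q y|) prodch W s (c i) y)).
  pose F j q y := if e * m%:R <= `|d (c j) q y| then prodch W s (c i) y else 0.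
  have F0 j q y : 0 <= F j q y by rewrite /F; case: ifP.
  rewrite big_mkcond.
  have -> : \sum_(j < N) \sum_q \sum_(y | e * m%:R <= `|d (c j) q y|) prodch W s (c i) y =
      \sum_y \sum_(j < N) \sum_q F j q y.
    rewrite [RHS]exchange_big; apply: eq_bigr => j _ /=; rewrite [RHS]exchange_big; apply: eq_bigr => q _.
    by rewrite [LHS]big_mkcond.
  apply: ler_sum => y _; case: ifP => [|_]; last by apply: sumr_ge0 => j _; apply: sumr_ge0.
  rewrite inE negb_forall => /existsP[j]; rewrite negb_imply => /andP[ji /existsPn ncomp].
  have /forallPn[q] := ncomp s; rewrite -ltNge => far.
  rewrite (bigD1 j) //= (bigD1 q) //= -addrA.
  have -> : F j q y = prodch W s (c i) y.
    rewrite /F; case: ifPn => //; rewrite -ltNge => dsmall; exfalso.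
    move: good; rewrite inE negb_exists => /forallP /(_ j); rewrite ji /= negbK.
    (* The input letter of [W] is a separate argument of [dev], which allows the two words to be
       swapped; here it is the codeword's own letter. *)
    move=> /forallP /(_ (q.1.1, q.1.2, q.1.1, q.2)) /= dv.
    move: far; apply/negP; rewrite -leNgt.
    have -> : emp (c i) (c j) y q.1.1 q.1.2 q.2 - jam_mean s (c j) q.1.1 q.1.2 q.2 =
       d (c j) q y + dev W s (c i) (c j) q.1.1 q.1.2 q.1.1 q.2.
      rewrite /d /dev /jam_mean mulr_sumr -addrA; congr (_ + _); rewrite -!sumrN -big_split /=.
      by apply: eq_bigr => t _; ring.
    by apply: le_trans (ler_normD _ _) _; move: dsmall dv; lra.
  by rewrite lerDl addr_ge0 // sumr_ge0 // => j' _; apply: sumr_ge0.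
rewrite -[X in X%:R * _]card_ord [leRHS]mulr_natl -[leRHS]sumr_const; apply: ler_sum => j _.
rewrite [leRHS]mulr_natl -[leRHS]sumr_const; apply: ler_sum => q _; exact: bound.
Qed.

End Decoder.

(** * Short codes with polynomially many messages *)

Section SmallCodes.
Local Open Scope classical_set_scope.
Variables (R : realType) (X Y S : finType) (W : S -> X -> Y -> R).
Hypothesis hW : forall s, is_channel (W s).
Variable x0 : X.

Lemma poly_le_expR (d : nat) (C c : R) : 0 < c ->
  \forall m \near \oo, C * m%:R ^+ d <= expR (c * m%:R).
Proof.
move=> c0; pose D := c ^+ d.+1 / d.+1`!%:R.
have D0 : 0 < D by rewrite divr_gt0 ?exprn_gt0 // ltr0n fact_gt0.
near=> m.
have Cm : C <= m%:R * D by rewrite -ler_pdivrMr //; near: m; exact: nbhs_infty_ger.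
have := @expR_ge1Dxn R (c * m%:R) d; rewrite mulr_ge0 ?(ltW c0) // => /(_ isT).
apply: le_trans; apply: ler_wpDl => //.
apply: (le_trans (ler_wpM2r _ Cm)); first by rewrite exprn_ge0.
by rewrite /D exprMn exprS [leRHS]mulrAC mulrCA mulrA mulrAC exprS mulrA.
Unshelve. all: by end_near. Qed.

(** Up to polynomial factors every failure costs [expR (- c0 * m)], while at most [G ^ m] pairs
    [(s, x')] have to be served. So a number of failures of order [ln G / c0] suffices, uniformly in
    [m] and [N]. *)
Lemma codebook_exists (e : R) (d : nat) : 0 < e <= 1 ->
  exists T0 : nat, \forall m \near \oo, forall N, (m <= N <= m ^ d)%N ->
    exists c : nat -> {ffun 'I_m -> X}, forall (s : {ffun 'I_m -> S}) x',
      (#|[set i : 'I_N | late_bad (correlated W e) c s x' i]%SET| <= T0)%N.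
Proof.
move=> /andP[e0 e1]; pose c0 := e ^+ 2 / 8.
have c0_gt0 : 0 < c0 by rewrite divr_gt0 ?exprn_gt0.
pose K : R := #|{: X * X * X * Y}|.+1%:R * 2.
have K0 : 0 < K by rewrite mulr_gt0.
pose G : R := #|S|.+1%:R * #|X|%:R.
have X1 : 1 <= #|X|%:R :> R by rewrite ler1n; apply/card_gt0P; exists x0.
have G1 : 1 <= G by rewrite /G -[leLHS]mulr1 ler_pM // ler1n.
pose T0 := Num.bound ((1 + ln G) * 2 / c0).
have T0_gt : (1 + ln G) * 2 / c0 < T0%:R.
  by apply: archi_boundP; rewrite divr_ge0 ?(ltW c0_gt0) // mulr_ge0 // addr_ge0 // ln_ge0.
exists T0; near=> m => N /andP[mN Nmd].
have m1 : (0 < m)%N by near: m; exact: nbhs_infty_gt.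
have m0R : 0 < m%:R :> R by rewrite ltr0n.
have N0 : (0 < N)%N := leq_trans m1 mN.
have N0R : 0 < N%:R :> R by rewrite ltr0n.
pose q := K * expR (- c0 * m%:R).
have q0 : 0 < q by rewrite mulr_gt0 ?expR_gt0.
have bc s (x' : {ffun 'I_m -> X}) :
    \sum_x (correlated W e s x x')%:R <= q * #|{: {ffun 'I_m -> X}}|%:R.
  apply: le_trans (correlated_card hW x0 _ _ _) _; first by rewrite (ltW e0).
  apply: ler_wpM2r => //; rewrite /q /K mulrA; apply: ler_wpM2r; first exact: expR_ge0.
  by apply: ler_wpM2r => //; rewrite ler_nat.
(* With this [th] the potential grows in total by at most [(1 + 1/N)^N], below [expR 1]. *)
pose th := (N%:R * N.+1%:R * q)^-1.
have NNq0 : 0 < N%:R * N.+1%:R * q by rewrite (mulr_gt0 _ q0) // mulr_gt0.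
have th0 : 0 < th by rewrite invr_gt0.
have [c Hc] := greedy_codebook (ltW q0) bc [ffun=> x0] (ltW th0) (leqnSn N).
exists c => s x'.
have -> : #|[set i : 'I_N | late_bad (correlated W e) c s x' i]%SET| =
    (\sum_(k < N) late_bad (correlated W e) c s x' k)%N.
  by rewrite -sum1dep_card big_mkcond /=; apply: eq_bigr => i _; case: late_bad.
set cnt := (\sum_(k < N) _)%N.
have le1 : (1 + th) ^+ cnt <= expR (1 + m%:R * ln G).
  apply: (@le_trans _ _ ((1 + th * (N.+1%:R * q)) ^+ N *
      (#|{: {ffun 'I_m -> S}}|%:R * #|{: {ffun 'I_m -> X}}|%:R))).
    apply: le_trans Hc; rewrite (bigD1 s) //= (bigD1 x') //= -addrA lerDl.
    rewrite addr_ge0 // sumr_ge0 // => *; last rewrite sumr_ge0 // => *;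
      by rewrite exprn_ge0 // addr_ge0 // ltW.
  rewrite expRD; apply: ler_pM.
  - by rewrite exprn_ge0 // addr_ge0 // mulr_ge0 ?(ltW th0) // mulr_ge0 // ltW.
  - by rewrite mulr_ge0.
  - have -> : th * (N.+1%:R * q) = N%:R^-1.
      by rewrite /th; field; rewrite !lt0r_neq0.
    rewrite -[X in _ <= expR X](divff (lt0r_neq0 N0R)) expRM_natl.
    apply: lerXn2r; rewrite ?nnegrE ?expR_ge0 ?addr_ge0 ?invr_ge0 //.
    exact: expR_ge1Dx.
  - rewrite expRM_natl lnK ?posrE; last by rewrite (lt_le_trans _ G1).
    rewrite !card_ffun !card_ord !natrX -exprMn; apply: lerXn2r; rewrite ?nnegrE ?mulr_ge0 //.
    by apply: ler_wpM2r => //; rewrite ler_nat.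
(* Half of the exponent [c0] absorbs the polynomial factor [N (N + 1)]. *)
have le2 : expR (c0 / 2 * m%:R) <= 1 + th.
  apply: (@le_trans _ _ th); last by rewrite lerDr.
  rewrite /th -[leLHS]invrK -expRN lef_pV2 ?posrE ?expR_gt0 //.
  have -> : - (c0 / 2 * m%:R) = c0 / 2 * m%:R + - c0 * m%:R :> R by field.
  rewrite expRD /q mulrA; apply: ler_wpM2r; first exact: expR_ge0.
  apply: (@le_trans _ _ (2 * K * m%:R ^+ (d + d))).
    have Nd : N%:R <= m%:R ^+ d :> R by rewrite -natrX ler_nat.
    have NS : N.+1%:R <= 2 * m%:R ^+ d :> R.
      by rewrite -natr1 mulr_natl mulr2n lerD // (le_trans _ Nd) // ler1n.
    have := ler_pM (ltW N0R) (ler0n R N.+1) Nd NS => /(ler_wpM2r (ltW K0)) /le_trans; apply.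
    by rewrite exprD; lra.
  by near: m; apply: poly_le_expR; rewrite divr_gt0.
have : expR (c0 / 2 * m%:R) ^+ cnt <= expR (1 + m%:R * ln G).
  apply: le_trans le1; apply: lerXn2r le2; rewrite nnegrE ?expR_ge0 //.
  by rewrite addr_ge0 // ltW.
rewrite -expRM_natl ler_expR => fin.
suff : cnt%:R <= T0%:R :> R by rewrite ler_nat.
apply: ltW; apply: le_lt_trans T0_gt; rewrite ler_pdivlMr //.
have m1R : 1 <= m%:R :> R by rewrite ler1n.
rewrite -(ler_pM2r m0R); lra.
Unshelve. all: by end_near. Qed.

(** The condition [m <= N] makes boundedly many misleading codewords a vanishing fraction;
    [N <= m ^ d] keeps the union over rivals harmless. Each effect is allotted [dl / 2]. *)
Lemma small_code (d : nat) (dl : R) : 0 < dl -> ~ symmetrizable W ->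
  \forall m \near \oo, forall N, (m <= N <= m ^ d)%N ->
    exists (pre : 'I_N -> {ffun 'I_m -> X}) (D : 'I_N -> {set {ffun 'I_m -> Y}}),
      (forall i j, i != j -> [disjoint D i & D j]%B) /\
      forall s : {ffun 'I_m -> S},
        (1 - dl) * N%:R <= \sum_(i < N) \sum_(y in D i) prodch W s (pre i) y.
Proof.
move=> dl0 /(nonsymmetrizable_gap hW x0)[xi xi0 gap].
pose u : R := #|X|%:R^-1.
have u0 : 0 < u by rewrite invr_gt0 (cardX_gt0 R x0).
(* The decoder works with [4 * e], and [compat_asym] needs [2 * (4 * e) < u * xi]. *)
pose e : R := Num.min 1 (u * xi / 16).
have e0 : 0 < e by rewrite lt_min ltr01 divr_gt0 // mulr_gt0.
have e1 : e <= 1 by rewrite ge_min lexx.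
have exi : 2 * (4 * e) < u * xi.
  have : e <= u * xi / 16 by rewrite ge_min lexx orbT.
  have := mulr_gt0 u0 xi0; lra.
have [|T0 HT0] := @codebook_exists e d; first by rewrite e0.
pose K : R := #|{: X * X * Y}|%:R * 2.
near=> m => N mNd; have /andP[mN Nmd] := mNd.
have m1 : (0 < m)%N by near: m; exact: nbhs_infty_gt.
have [c Hc] : exists c : nat -> {ffun 'I_m -> X}, forall (s : {ffun 'I_m -> S}) x',
      (#|[set i : 'I_N | late_bad (correlated W e) c s x' i]%SET| <= T0)%N.
  by move: N mNd {mN Nmd}; near: m.
exists (fun i => c i), (fun i => decset W (4 * e) c i); split.
  move=> i j ij; rewrite finset.disjoints_subset; apply/fintype.subsetP => y; rewrite !inE.
  move=> /forallP /(_ j); rewrite eq_sym ij /= => cij; apply/negP => /forallP /(_ i).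
  by rewrite ij /=; apply/negP; exact: (compat_asym x0 m1 exi gap cij).
move=> s; have mc := misleading_card x0 (ltW e0) Hc s.
pose bad := misleading W (3 * e) c N s.
pose p := N%:R * (#|{: X * X * Y}|%:R * (2 * expR (- (e ^+ 2 / 8) * m%:R))).
have p0 : 0 <= p by rewrite !mulr_ge0 ?expR_ge0.
apply: (@le_trans _ _ (\sum_(i < N) (1 - p - (i \in bad)%:R))); last first.
  apply: ler_sum => i _; case: (boolP (i \in bad)) => ib /=.
    by apply: (@le_trans _ _ 0); [lra|apply: sumr_ge0 => y _; exact: prodch_ge0].
  rewrite subr0 lerBlDr -[leLHS](prodch_sum1 hW s (c i)) (bigID (fun y => y \in decset W (4 * e) c i)) /= lerD2l.
  by apply: (decset_fail hW) => //; rewrite (ltW e0).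
rewrite sumrB sumr_const card_ord -natr_sum.
have -> : (\sum_(i < N) (i \in bad) = #|bad|)%N.
  by rewrite -sum1_card [RHS]big_mkcond /=; apply: eq_bigr => i _; case: (_ \in _).
have : #|bad|%:R <= (T0 + T0 * T0)%:R :> R by rewrite ler_nat.
have : (T0 + T0 * T0)%:R <= dl / 2 * N%:R.
  apply: (@le_trans _ _ (dl / 2 * m%:R)); last by rewrite ler_wpM2l ?ler_nat // ltW // divr_gt0.
  rewrite mulrC -ler_pdivrMr ?divr_gt0 //; near: m; exact: nbhs_infty_ger.
have : p <= dl / 2.
  have Nd : N%:R <= m%:R ^+ d :> R by rewrite -natrX ler_nat.
  have -> : p = K * N%:R / expR (e ^+ 2 / 8 * m%:R) by rewrite /p /K mulNr expRN; ring.
  rewrite ler_pdivrMr ?expR_gt0 // -ler_pdivrMl ?divr_gt0 //.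
  apply: (@le_trans _ _ ((dl / 2)^-1 * K * m%:R ^+ d)).
    rewrite -mulrA; apply: ler_wpM2l; first by rewrite invr_ge0 ltW // divr_gt0.
    by apply: ler_wpM2l => //; rewrite mulr_ge0.
  by near: m; apply: poly_le_expR; rewrite divr_gt0 ?exprn_gt0.
have N0 : 0 <= N%:R :> R by [].
rewrite -[_ *+ N]mulr_natr => h1 h2 h3.
have := ler_wpM2r N0 h1; lra.
Unshelve. all: by end_near. Qed.

End SmallCodes.

(** * The jamming attack on a symmetrizable channel *)

Section Jamming.
Variables (R : realType) (X Y S : finType) (W : S -> X -> Y -> R).
Hypothesis hW : forall s, is_channel (W s).

(* The jammer draws a message [k'] and a codeword [x'] for it, and feeds [x'] to
   the symmetrizing channel: the receiver cannot tell [(x, x')] from [(x', x)]. *)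
Lemma symmetrizable_success n K (e : 'I_K -> {ffun 'I_n -> X} -> R)
    (D : 'I_K -> {set {ffun 'I_n -> Y}}) (v : R) :
  (0 < K)%N -> symmetrizable W ->
  (forall k x, 0 <= e k x) -> (forall k, \sum_x e k x = 1) ->
  (forall k k', k != k' -> [disjoint D k & D k']) ->
  (forall s, v <= \sum_k \sum_x e k x * \sum_(y in D k) prodch W s x y) ->
  2 * v <= K%:R + 1.
Proof.
move=> K0 [U [hU symU]] e0 e1 dis hv.
pose I := ('I_K * {ffun 'I_n -> X})%type.
pose ep (p : I) := e p.1 p.2.
have ep0 p : 0 <= ep p by exact: e0.
have sum_ep : \sum_p ep p = K%:R.
  by rewrite -(pair_bigA _ (fun k x => e k x)) /= (eq_bigr (fun=> 1)) ?sumr_const ?card_ord.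
(* The averaged channel seen by the receiver when [x] is sent and the jammer uses [x']. *)
pose M (x x' : {ffun 'I_n -> X}) (y : {ffun 'I_n -> Y}) :=
  \prod_(t < n) \sum_s U (x' t) s * W s (x t) (y t).
have Msym x x' y : M x x' y = M x' x y by apply: eq_bigr => t _; rewrite symU.
have M0 x x' y : 0 <= M x x' y.
  by apply: prodr_ge0 => t _; apply: sumr_ge0 => s _; rewrite mulr_ge0 ?(hU _).1 ?(hW _ _).1.
have M1 x x' : \sum_y M x x' y = 1.
  rewrite /M (sum_prod_ffun (fun t y => \sum_s U (x' t) s * W s (x t) y)) big1 // => t _.
  rewrite exchange_big -[RHS](hU (x' t)).2; apply: eq_bigr => s _.
  by rewrite -mulr_sumr (hW _ _).2 mulr1.
have MU (x x' : {ffun 'I_n -> X}) y : \sum_(s : {ffun 'I_n -> S}) (\prod_(t < n) U (x' t) (s t)) * prodch W s x y = M x x' y.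
  rewrite /M -(sum_prod_ffun (fun t s => U (x' t) s * W s (x t) (y t))).
  by apply: eq_bigr => s _; rewrite -big_split.
pose B (p p' : I) := \sum_(y in D p.1) M p.2 p'.2 y.
have Bsub (A : {pred {ffun 'I_n -> Y}}) x x' : \sum_(y in A) M x x' y <= 1.
  by rewrite -(M1 x x') [leRHS](bigID (fun y => y \in A)) /= lerDl sumr_ge0.
(* For different messages both terms weigh disjoint sets by the same law [M]. *)
have BB p p' : B p p' + B p' p <= 1 + (p.1 == p'.1)%:R.
  have [_|pp] := eqVneq p.1 p'.1; first by rewrite lerD ?Bsub.
  rewrite addr0 /B; under [X in _ + X]eq_bigr do rewrite Msym.
  rewrite -bigU; last exact: dis.
  exact: Bsub.
(* The jammer's law on state sequences, of total mass [K] because messages are not divided by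
   [K]. *)
pose om (s : {ffun 'I_n -> S}) := \sum_p' ep p' * \prod_(t < n) U (p'.2 t) (s t).
pose F (s : {ffun 'I_n -> S}) := \sum_p ep p * \sum_(y in D p.1) prodch W s p.2 y.
have om0 s : 0 <= om s.
  by apply: sumr_ge0 => p _; rewrite mulr_ge0 // prodr_ge0 // => t _; exact: (hU _).1.
have om1 : \sum_s om s = K%:R.
  rewrite /om exchange_big -sum_ep; apply: eq_bigr => p _ /=.
  rewrite -mulr_sumr (sum_prod_ffun (fun t s => U (p.2 t) s)) big1 ?mulr1 // => t _.
  exact: (hU _).2.
have hF s : v <= F s by rewrite /F -(pair_bigA _ (fun k x => e k x * \sum_(y in D k) prodch W s x y)).
have lower : K%:R * v <= \sum_s om s * F s.
  by rewrite -om1 mulr_suml; apply: ler_sum => s _; exact: ler_wpM2l.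
have expand : \sum_s om s * F s = \sum_p \sum_p' ep p * ep p' * B p p'.
  under eq_bigr do rewrite /om /F big_distrlr /=.
  rewrite exchange_big /=; under eq_bigr do rewrite exchange_big /=.
  rewrite exchange_big /=; apply: eq_bigr => p _; apply: eq_bigr => p' _.
  under [X in _ = _ * X]eq_bigr do rewrite -MU.
  rewrite [X in _ = _ * X]exchange_big /= mulr_sumr; apply: eq_bigr => s _.
  by rewrite -mulr_sumr; ring.
have upper : 2 * (\sum_p \sum_p' ep p * ep p' * B p p') <= K%:R * (K%:R + 1).
  rewrite mulr_natl mulr2n {2}exchange_big -big_split /=.
  apply: (@le_trans _ _ (\sum_p ep p * (\sum_p' (ep p' + ep p' * (p.1 == p'.1)%:R)))).
    apply: ler_sum => p _; rewrite -big_split mulr_sumr; apply: ler_sum => p' _ /=.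
    rewrite [ep p' * ep p]mulrC -mulrDr -mulrA; apply: ler_wpM2l => //.
    by rewrite -[X in _ <= X + _]mulr1 -mulrDr; apply: ler_wpM2l.
  rewrite (eq_bigr (fun p => ep p * (K%:R + 1))) -?mulr_suml ?sum_ep // => p _.
  congr (_ * _); rewrite big_split /= sum_ep; congr (_ + _).
  rewrite -(pair_bigA _ (fun k x => e k x * (p.1 == k)%:R)) /= (bigD1 p.1) //= eqxx.
  rewrite [X in _ + X]big1 => [|k /negbTE kp]; last by rewrite big1 // => x _; rewrite eq_sym kp mulr0.
  by rewrite addr0; under eq_bigr do rewrite mulr1; rewrite e1.
have K0R : 0 < K%:R :> R by rewrite ltr0n.
by rewrite -(ler_pM2l K0R); move: lower upper; rewrite expand; lra.
Qed.

End Jamming.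

Arguments cK {R X Y n} c.
Arguments cG {R X Y n} c.
Arguments enc {R X Y n} c _ _ _.
Arguments dec {R X Y n} c _ _.
Arguments joint {R X Y Z S n} V c sn g k zn.

(** * Error and number of messages of a code *)

Section CodeFacts.
Variables (R : realType) (X Y S : finType) (W : S -> X -> Y -> R).
Hypothesis hW : forall s, is_channel (W s).
Variable n : nat.
Implicit Types (c : Defs.code R X Y n) (s : {ffun 'I_n -> S}).

Lemma valid_enc_ge0 c g k x : valid_code c -> 0 <= enc c g k x.
Proof. by move=> [_ _ /(_ g k tt)[]]. Qed.

Lemma valid_enc_sum1 c g k : valid_code c -> \sum_x enc c g k x = 1.
Proof. by move=> [_ _ /(_ g k tt)[]]. Qed.

Lemma avg_err_succ c s : 1 - avg_err W c <= succ W c s.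
Proof. by rewrite subKr; exact: bigmin_le. Qed.

Lemma avg_err_le c (d : R) : 0 <= d -> (forall s, 1 - d <= succ W c s) -> avg_err W c <= d.
Proof.
move=> d0 cd; rewrite lerBlDr -lerBlDl; apply: le_bigmin => [|s _]; last exact: cd.
by rewrite gerBl.
Qed.

Lemma avg_err_ge0 c : 0 <= avg_err W c.
Proof. by rewrite subr_ge0; exact: bigmin_le_id. Qed.

Definition key_succ c s g k : R :=
  \sum_x enc c g k x * \sum_(y in dec c g k) prodch W s x y.

Arguments key_succ : clear implicits.

Lemma key_succ_ge0 c s g k : valid_code c -> 0 <= key_succ c s g k.
Proof.
move=> vc; apply: sumr_ge0 => x _; rewrite mulr_ge0 ?valid_enc_ge0 // sumr_ge0 // => y _.
exact: prodch_ge0.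
Qed.

Lemma key_succ_le1 c s g k : valid_code c -> key_succ c s g k <= 1.
Proof.
move=> vc; rewrite -(valid_enc_sum1 g k vc); apply: ler_sum => x _.
by rewrite ler_piMr ?valid_enc_ge0 // prodch_sum_le1.
Qed.

(** Each output word lies in at most one decoding set and contributes at most 1. This is what bounds
    the rates. *)
Lemma key_succ_sum_le c s g : valid_code c ->
  \sum_k key_succ c s g k <= (#|Y| ^ n)%:R.
Proof.
move=> vc; case: (vc) => _ _ _ dis.
apply: (@le_trans _ _ (\sum_k \sum_(y in dec c g k) 1)).
  apply: ler_sum => k _; rewrite /key_succ.
  under eq_bigr do rewrite mulr_sumr; rewrite exchange_big; apply: ler_sum => y _ /=.
  rewrite -(valid_enc_sum1 g k vc); apply: ler_sum => x _.
  rewrite ler_piMr ?valid_enc_ge0 // -(prodch_sum1 hW s x) (bigD1 y) //= lerDl.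
  by apply: sumr_ge0 => y' _; exact: prodch_ge0.
have -> : (#|Y| ^ n)%:R = \sum_(y : {ffun 'I_n -> Y}) 1 :> R.
  by rewrite sumr_const card_ffun card_ord.
under eq_bigr do rewrite big_mkcond /=.
rewrite exchange_big; apply: ler_sum => y _ /=.
have [/existsP[k yk]|/existsPn none] := boolP [exists k, y \in dec c g k].
  rewrite (bigD1 k) //= yk big1 ?addr0 // => k' kk'; case: ifP => // yk'.
  by have /disjointFr/(_ yk') := dis g _ _ kk'; rewrite yk.
by rewrite big1 // => k _; rewrite (negbTE (none k)).
Qed.

Lemma succE c s : succ W c s =
  ((cK c)%:R * (cG c)%:R)^-1 * \sum_g \sum_k key_succ c s g k.
Proof. by rewrite /succ exchange_big. Qed.

Lemma succ_le c s : valid_code c -> succ W c s <= (#|Y| ^ n)%:R / (cK c)%:R.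
Proof.
move=> vc; case: (vc) => K0 G0 _ _; rewrite succE invfM -mulrA [leRHS]mulrC.
have G0R : 0 < (cG c)%:R :> R by rewrite ltr0n.
rewrite ler_pM2l ?invr_gt0 ?ltr0n // mulrC ler_pdivrMr // mulr_natr.
rewrite -[X in _ *+ X]card_ord -sumr_const; apply: ler_sum => g _.
exact: key_succ_sum_le.
Qed.

Lemma messages_le c (s0 : S) : valid_code c -> avg_err W c <= 1 / 2 ->
  (cK c)%:R <= 2 * (#|Y| ^ n)%:R :> R.
Proof.
move=> vc ce; case: (vc) => K0 _ _ _.
have := avg_err_succ c [ffun=> s0]; have := succ_le [ffun=> s0] vc.
have K0R : 0 < (cK c)%:R :> R by rewrite ltr0n.
move=> h1 h2; have : 1 / 2 <= (#|Y| ^ n)%:R / (cK c)%:R :> R by lra.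
by rewrite ler_pdivlMr //; lra.
Qed.

(** The jamming bound reads [2 (1 - err) K <= K + 1], which with [err < 1/4] forces [K < 2]. *)
Lemma symmetrizable_one_message c : symmetrizable W -> valid_code c -> cG c = 1%N ->
  avg_err W c < 1 / 4 -> cK c = 1%N.
Proof.
move=> symW vc; case: (vc) => K0 _ _ dis; case: c vc K0 dis => K G e D vc /= K0 dis G1.
move: e D vc dis; rewrite G1 => {G1} e D vc dis err.
have K0R : 0 < K%:R :> R by rewrite ltr0n.
have : 2 * ((1 - avg_err W (Code e D)) * K%:R) <= K%:R + 1.
  apply: (@symmetrizable_success R X Y S W hW n K (e ord0) (D ord0)) => //.
  - by move=> k x; exact: (@valid_enc_ge0 (Code e D) ord0 k x vc).
  - by move=> k; exact: (@valid_enc_sum1 (Code e D) ord0 k vc).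
  - exact: dis.
  - move=> s; have := avg_err_succ (Code e D) s.
    by rewrite succE /= big_ord1 mulr1 mulrC ler_pdivlMr.
move=> h; apply/eqP; rewrite eqn_leq K0 andbT -ltnS -(ltr_nat R).
have := ltr_pM2r K0R (avg_err W (Code e D)) (1 / 4); rewrite err; lra.
Qed.

End CodeFacts.
Arguments key_succ {R X Y S} W {n} c s g k.

(** * Words in two blocks, and information when the key is revealed *)

Section Blocks.
Variables (A : finType) (m n : nat).
Implicit Types (f : {ffun 'I_(m + n) -> A}) (h : {ffun 'I_m -> A}) (k : {ffun 'I_n -> A}).

Definition lpart f : {ffun 'I_m -> A} := [ffun i => f (lshift n i)].
Definition rpart f : {ffun 'I_n -> A} := [ffun i => f (rshift m i)].
Definition glue (h : {ffun 'I_m -> A}) (k : {ffun 'I_n -> A}) :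
    {ffun 'I_(m + n) -> A} :=
  [ffun i => match fintype.split i with inl j => h j | inr j => k j end].

Lemma lpart_glue h k : lpart (glue h k) = h.
Proof. by apply/ffunP => i; rewrite !ffunE (unsplitK (inl i)). Qed.

Lemma rpart_glue h k : rpart (glue h k) = k.
Proof. by apply/ffunP => i; rewrite !ffunE (unsplitK (inr i)). Qed.

Lemma glue_parts f : glue (lpart f) (rpart f) = f.
Proof. by apply/ffunP => i; rewrite ffunE; case: split_ordP => j ->; rewrite ffunE. Qed.

Lemma sum_blocks (R : realType) (F : {ffun 'I_m -> A} -> {ffun 'I_n -> A} -> R) :
  \sum_f F (lpart f) (rpart f) = \sum_h \sum_k F h k.
Proof.
rewrite pair_bigA (reindex (fun p : {ffun 'I_m -> A} * {ffun 'I_n -> A} => glue p.1 p.2)) /=.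
  by apply: eq_bigr => p _; rewrite lpart_glue rpart_glue.
exists (fun f => (lpart f, rpart f)) => [[h k]|f] _ /=; last exact: glue_parts.
by rewrite lpart_glue rpart_glue.
Qed.

End Blocks.

Lemma prodch_blocks (R : realType) (X Y S : finType) (W : S -> X -> Y -> R) m n
    (s : {ffun 'I_(m + n) -> S}) x y :
  prodch W s x y = prodch W (lpart s) (lpart x) (lpart y) *
                   prodch W (rpart s) (rpart x) (rpart y).
Proof.
rewrite /prodch big_split_ord /=; congr (_ * _); apply: eq_bigr => i _; by rewrite !ffunE.
Qed.

Lemma ln2_gt0 (R : realType) : 0 < ln 2 :> R.
Proof. by rewrite ln_gt0 // ltr1n. Qed.

(* Handing the observer the key [g] as well can only help; given [g], the first
   block carries no information on [k]. *)
Lemma mutinf_le_cmutinf (R : realType) (A C Z Z1 Z2 : finType)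
    (l : Z -> Z1) (r : Z -> Z2) (al : C -> Z1 -> R) (q : C -> A -> Z2 -> R) :
  (forall F : Z1 -> Z2 -> R, \sum_z F (l z) (r z) = \sum_z1 \sum_z2 F z1 z2) ->
  is_channel al -> (forall g k z2, 0 <= q g k z2) ->
  (forall g k, \sum_z2 q g k z2 = (#|A|%:R * #|C|%:R)^-1) ->
  mutinf (fun k z => \sum_g al g (l z) * q g k (r z)) <= cmutinf q.
Proof.
move=> sumZ hal q0 q1; pose t g k z2 :=
  if 0 < q g k z2 then q g k z2 * log2 (q g k z2 * (\sum_k' \sum_z' q g k' z')
                       / ((\sum_z' q g k z') * (\sum_k' q g k' z2))) else 0.
have -> : cmutinf q = \sum_k \sum_z \sum_g al g (l z) * t g k (r z).
  rewrite /cmutinf exchange_big; apply: eq_bigr => k _ /=.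
  rewrite (sumZ (fun z1 z2 => \sum_g al g z1 * t g k z2)).
  under [RHS]eq_bigr do rewrite exchange_big /=.
  rewrite [RHS]exchange_big; apply: eq_bigr => g _ /=.
  under [RHS]eq_bigr do rewrite -mulr_sumr.
  by rewrite -mulr_suml (hal g).2 mul1r.
apply: ler_sum => k _; apply: ler_sum => z _.
have A0 : 0 < #|A|%:R :> R by rewrite ltr0n; apply/card_gt0P; exists k.
pose Q g := \sum_k' q g k' (r z).
have al0 g z1 : 0 <= al g z1 by exact: (hal g).1.
have Q0 g : 0 <= Q g by apply: sumr_ge0.
have qQ g : Q g = 0 -> q g k (r z) = 0.
  by move=> /(psumr_eq0P (fun k' _ => q0 g k' (r z))); apply.
pose a g := al g (l z) * q g k (r z).
have a0 g : 0 <= a g by rewrite mulr_ge0.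
case: ifPn => [p0|]; last first.
  rewrite -leNgt => p0.
  have pz : \sum_g a g = 0 by apply/eqP; rewrite eq_le p0 sumr_ge0.
  rewrite big1 // => g _; have /eqP := psumr_eq0P (fun g _ => a0 g) pz (i := g) isT.
  rewrite mulf_eq0 => /orP[/eqP ->|/eqP qz]; first by rewrite mul0r.
  by rewrite /t qz ltxx mulr0.
have C0 : 0 < #|C|%:R :> R.
  rewrite ltr0n lt0n; apply/eqP => C0; move: p0; rewrite big1 ?ltxx // => g _.
  by have := card0_eq C0 g; rewrite inE.
(* The message is uniform under every key, so the [b g] sum to the product of the two marginals;
   log-sum is then applied over the keys. *)
pose b g := al g (l z) * (#|A|%:R^-1 * Q g).
have Pk : \sum_z' \sum_g al g (l z') * q g k (r z') = #|A|%:R^-1.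
  rewrite (sumZ (fun z1 z2 => \sum_g al g z1 * q g k z2)).
  under eq_bigr do rewrite exchange_big /=.
  rewrite exchange_big /= (eq_bigr (fun=> (#|A|%:R * #|C|%:R)^-1)) => [|g _].
    by rewrite sumr_const -[LHS]mulr_natr; field; rewrite !lt0r_neq0.
  under eq_bigr do rewrite -mulr_sumr.
  by rewrite -mulr_suml (hal g).2 mul1r q1.
have PP : (\sum_z' \sum_g al g (l z') * q g k (r z')) *
    (\sum_k' \sum_g al g (l z) * q g k' (r z)) = \sum_g b g.
  rewrite Pk exchange_big mulr_sumr; apply: eq_bigr => g _ /=.
  by rewrite -mulr_sumr mulrCA.
rewrite PP {1}/log2 mulrA ler_pdivrMr ?ln2_gt0 //.
apply: le_trans (@log_sum R C a b a0 _ _ p0) _.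
- by move=> g; rewrite mulr_ge0 // mulr_ge0 // invr_ge0 ltW.
- move=> g /eqP; rewrite /a mulf_eq0 => /orP[/eqP -> |]; first by rewrite mul0r.
  rewrite mulf_eq0 invr_eq0 (gt_eqF A0) /= => /eqP /qQ ->; by rewrite mulr0.
rewrite mulr_suml; apply: ler_sum => g _; case: ifPn => [ag|]; last first.
  rewrite -leNgt => ag; have : a g == 0 by rewrite eq_le ag a0.
  rewrite mulf_eq0 => /orP[/eqP ->|/eqP qz]; first by rewrite !mul0r.
  by rewrite /t qz ltxx mulr0 mul0r.
have alg : 0 < al g (l z).
  by rewrite lt_def al0 andbT; apply: contraTneq ag => h; rewrite /a h mul0r ltxx.
have qg : 0 < q g k (r z).
  by rewrite lt_def q0 andbT; apply: contraTneq ag => h; rewrite /a h mulr0 ltxx.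
have Qg : 0 < Q g.
  by rewrite lt_def Q0 andbT; apply: contraTneq qg => /qQ ->; rewrite ltxx.
rewrite /t qg /a -!mulrA ler_pM2l // ler_pM2l // mulVf ?lt0r_neq0 ?ln2_gt0 // mulr1.
(* The prefix weight [al g (l z)] cancels inside the logarithm. *)
rewrite le_eqVlt; apply/orP; left; apply/eqP; congr ln; rewrite /b -/(Q g).
rewrite (eq_bigr (fun=> (#|A|%:R * #|C|%:R)^-1)) // q1 sumr_const.
rewrite -[_ *+ #|_|]mulr_natr.
by field; rewrite !lt0r_neq0.
Qed.

(** * Sending the key ahead of the message *)

Section PrefixedCode.
Variables (R : realType) (X Y S : finType) (m n : nat) (c : Defs.code R X Y n).
Variables (pre : 'I_(cG c) -> {ffun 'I_m -> X}) (D : 'I_(cG c) -> {set {ffun 'I_m -> Y}}).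
Hypothesis vc : valid_code c.
Hypothesis disD : forall g g', g != g' -> [disjoint D g & D g'].

(** The key becomes local randomness of the stochastic encoder, hence a single key remains. The
    receiver accepts [k] if some key fits both blocks. *)
Definition prefixed : Defs.code R X Y (m + n) := @Code R X Y (m + n) (cK c) 1%N
  (fun _ k x => (cG c)%:R^-1 * \sum_g (lpart x == pre g)%:R * enc c g k (rpart x))
  (fun _ k => [set y | [exists g, (lpart y \in D g) && (rpart y \in dec c g k)]]).

Let G0 : 0 < (cG c)%:R :> R. Proof. by rewrite ltr0n; case: vc. Qed.
Let K0 : 0 < (cK c)%:R :> R. Proof. by rewrite ltr0n; case: vc. Qed.

Lemma prefixed_enc_sum g k (f : {ffun 'I_m -> X} -> {ffun 'I_n -> X} -> R) :
  \sum_x enc prefixed g k x * f (lpart x) (rpart x) =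
  (cG c)%:R^-1 * \sum_h \sum_x2 enc c h k x2 * f (pre h) x2.
Proof.
rewrite (sum_blocks (fun x1 x2 => ((cG c)%:R^-1 * \sum_h (x1 == pre h)%:R * enc c h k x2) * f x1 x2)).
under eq_bigr do under eq_bigr do rewrite -mulrA mulr_suml.
under eq_bigr do rewrite -mulr_sumr exchange_big /=.
rewrite -mulr_sumr exchange_big /=; congr (_ * _); apply: eq_bigr => h _.
rewrite (bigD1 (pre h)) //= [X in _ + X]big1 ?addr0 => [|x1 /negbTE ->].
  by apply: eq_bigr => x2 _; rewrite eqxx mul1r.
by rewrite big1 // => x2 _; rewrite !mul0r.
Qed.

Lemma prefixed_valid : valid_code prefixed.
Proof.
case: (vc) => cK0 cG0 _ dis; split => //.
- move=> g k _; split => [x|].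
    rewrite mulr_ge0 ?invr_ge0 // sumr_ge0 // => h _; rewrite mulr_ge0 //.
    exact: valid_enc_ge0.
  have := prefixed_enc_sum g k (fun _ _ => 1).
  under eq_bigr do rewrite mulr1; move=> ->.
  rewrite (eq_bigr (fun=> 1)) => [|h _].
    by rewrite sumr_const card_ord mulVf // lt0r_neq0.
  by under eq_bigr do rewrite mulr1; rewrite valid_enc_sum1.
- move=> g0 k k' kk' /=; rewrite finset.disjoints_subset; apply/fintype.subsetP => y; rewrite !inE.
  move=> /existsP[g /andP[yg ygk]]; apply/existsPn => g'; apply/negP => /andP[yg' ygk'].
  have [gg'|gg'] := eqVneq g g'.
    by rewrite -gg' in ygk'; have := disjointFr (dis g k k' kk') ygk; rewrite ygk'.
  by have := disjointFr (disD gg') yg; rewrite yg'.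
Qed.

(** Given the key, the successes of the two blocks multiply. Both are good only on average over the
    key, so the product is bounded below by [a + b - 1], which averages separately. *)
Lemma prefixed_err (W : S -> X -> Y -> R) (dl : R) : (forall s, is_channel (W s)) -> 0 <= dl ->
  (forall s, (1 - dl) * (cG c)%:R <= \sum_g \sum_(y in D g) prodch W s (pre g) y) ->
  avg_err W prefixed <= dl + avg_err W c.
Proof.
move=> hW dl0 hD; apply: avg_err_le => [|s]; first by rewrite addr_ge0 // avg_err_ge0.
set s1 := lpart s; set s2 := rpart s.
pose a g := \sum_(y in D g) prodch W s1 (pre g) y.
have key k : (cG c)%:R^-1 * (\sum_g (a g * key_succ W c s2 g k)) <= key_succ W prefixed s ord0 k.
  pose f x1 x2 := \sum_(y in dec prefixed ord0 k)
    prodch W s1 x1 (lpart y) * prodch W s2 x2 (rpart y).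
  have -> : key_succ W prefixed s ord0 k =
      \sum_x enc prefixed ord0 k x * f (lpart x) (rpart x).
    by apply: eq_bigr => x _; congr (_ * _); apply: eq_bigr => y _; rewrite prodch_blocks.
  rewrite prefixed_enc_sum ler_pM2l ?invr_gt0 //; apply: ler_sum => g _.
  rewrite /key_succ mulr_sumr; apply: ler_sum => x2 _.
  rewrite mulrCA; apply: ler_wpM2l; first exact: valid_enc_ge0.
  rewrite /a big_distrlr /=.
  rewrite big_mkcond; under eq_bigr do rewrite big_mkcond /=.
  pose F y1 y2 := if y1 \in D g then if y2 \in dec c g k then
     prodch W s1 (pre g) y1 * prodch W s2 x2 y2 else 0 else 0.
  have -> : \sum_y1 (if y1 \in D g then \sum_y2 (if y2 \in dec c g k then
     prodch W s1 (pre g) y1 * prodch W s2 x2 y2 else 0) else 0) = \sum_y F (lpart y) (rpart y).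
    rewrite sum_blocks; apply: eq_bigr => y1 _; rewrite /F; case: (_ \in _) => //.
    by rewrite big1.
  rewrite /f [leRHS]big_mkcond; apply: ler_sum => y _; rewrite /F.
  have P0 : 0 <= prodch W s1 (pre g) (lpart y) * prodch W s2 x2 (rpart y).
    by rewrite mulr_ge0 // prodch_ge0.
  case: ifP => yD; last by case: ifP.
  case: ifP => yd; last by case: ifP.
  by rewrite inE; case: existsP => // -[]; exists g; rewrite yD yd.
have a01 g : 0 <= a g <= 1.
  by rewrite sumr_ge0 ?prodch_sum_le1 // => y _; exact: prodch_ge0.
rewrite succE /= mulr1 big_ord1.
apply: (@le_trans _ _ ((cK c)%:R^-1 * \sum_k ((cG c)%:R^-1 *
    (\sum_g (a g + key_succ W c s2 g k - 1))))); last first.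
  rewrite ler_pM2l ?invr_gt0 //; apply: ler_sum => k _; apply: le_trans (key k).
  rewrite ler_pM2l ?invr_gt0 //; apply: ler_sum => g _.
  have := key_succ_le1 hW s2 g k vc; have := key_succ_ge0 hW s2 g k vc; have /andP[] := a01 g.
  by nra.
have -> : (cK c)%:R^-1 * \sum_k ((cG c)%:R^-1 * (\sum_g (a g + key_succ W c s2 g k - 1))) =
    (cG c)%:R^-1 * (\sum_g a g) + succ W c s2 - 1.
  rewrite succE -mulr_sumr exchange_big /=.
  have -> : \sum_g \sum_k (a g + key_succ W c s2 g k - 1) =
     (cK c)%:R * (\sum_g a g) + \sum_g \sum_k key_succ W c s2 g k - (cK c)%:R * (cG c)%:R.
    rewrite (eq_bigr (fun g => (cK c)%:R * a g + \sum_k key_succ W c s2 g k - (cK c)%:R)).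
      by rewrite !big_split /= -mulr_sumr sumr_const card_ord mulNrn mulr_natr.
    by move=> g _; rewrite !big_split /= !sumr_const card_ord mulNrn mulr_natl.
  by field; rewrite !lt0r_neq0.
have := hD s1; rewrite -ler_pdivlMr // mulrC -/(a _) => h; have := avg_err_succ W c s2.
by move: h; lra.
Qed.

Lemma prefixed_leak (Z : finType) (V : S -> X -> Z -> R) : (forall s, is_channel (V s)) ->
  max_leak V prefixed <= max_cleak V c.
Proof.
move=> hV; apply: bigmax_le => [|s _]; first exact: bigmax_ge_id.
apply: le_trans (le_bigmax _ _ (rpart s)).
have q1 g k : \sum_z2 joint V c (rpart s) g k z2 = ((cK c)%:R * (cG c)%:R)^-1.
  rewrite -mulr_sumr exchange_big /= (_ : \sum_x _ = 1) ?mulr1 //.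
  rewrite -[RHS](valid_enc_sum1 g k vc); apply: eq_bigr => x _.
  by rewrite -mulr_sumr prodch_sum1 // mulr1.
have := @mutinf_le_cmutinf R 'I_(cK c) 'I_(cG c) {ffun 'I_(m + n) -> Z} _ _
  (@lpart Z m n) (@rpart Z m n) (fun g => prodch V (lpart s) (pre g)) (joint V c (rpart s)).
rewrite !card_ord => /(_ _ _ _ q1) h.
apply: le_trans (h _ _ _); last 3 first.
- exact: sum_blocks.
- by move=> g; split => [z|]; [exact: prodch_ge0|exact: prodch_sum1].
- move=> g k z; rewrite mulr_ge0 ?invr_ge0 ?mulr_ge0 ?ler0n // sumr_ge0 // => x _.
  by rewrite mulr_ge0 ?prodch_ge0 ?valid_enc_ge0.
rewrite /leak le_eqVlt; apply/orP; left; apply/eqP; congr mutinf.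
apply/funext => k; apply/funext => z; rewrite big_ord1 /joint /=.
have -> : \sum_x enc prefixed ord0 k x * prodch V s x z = \sum_x enc prefixed ord0 k x *
   (prodch V (lpart s) (lpart x) (lpart z) * prodch V (rpart s) (rpart x) (rpart z)).
  by apply: eq_bigr => x _; rewrite prodch_blocks.
rewrite (prefixed_enc_sum _ _ (fun x1 x2 => prodch V (lpart s) x1 (lpart z) * prodch V (rpart s) x2 (rpart z))).
rewrite mulr1 mulrA -invfM mulr_sumr; apply: eq_bigr => g _.
rewrite mulrCA; congr (_ * _); rewrite mulr_sumr; apply: eq_bigr => x _; ring.
Qed.

End PrefixedCode.

(** * Reducing the number of keys *)

Section KeyReduction.
Variables (R : realType) (X Y Z S : finType).
Variables (W : S -> X -> Y -> R) (V : S -> X -> Z -> R).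
Hypotheses (hW : forall s, is_channel (W s)) (hV : forall s, is_channel (V s)).
Variable n : nat.
Implicit Types (c : Defs.code R X Y n) (s : {ffun 'I_n -> S}) (z : {ffun 'I_n -> Z}).

Definition key_joint c s g k z : R :=
  (cK c)%:R^-1 * \sum_x enc c g k x * prodch V s x z.
Arguments key_joint : clear implicits.

(** The information between message and observation under the key [g]; the message marginal [1 / K]
    appears as the factor [K]. *)
Definition key_info c s g : R :=
  \sum_k \sum_z (if 0 < key_joint c s g k z then
    key_joint c s g k z * log2 (key_joint c s g k z * (cK c)%:R / \sum_k' key_joint c s g k' z)
    else 0).
Arguments key_info : clear implicits.

Lemma key_joint_ge0 c s g k z : valid_code c -> 0 <= key_joint c s g k z.
Proof.
move=> vc; rewrite mulr_ge0 ?invr_ge0 // sumr_ge0 // => x _.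
by rewrite mulr_ge0 ?valid_enc_ge0 ?prodch_ge0.
Qed.

Lemma key_joint_row c s g k : valid_code c -> \sum_z key_joint c s g k z = (cK c)%:R^-1.
Proof.
move=> vc; rewrite -mulr_sumr exchange_big /= (eq_bigr (fun x => enc c g k x)).
  by rewrite valid_enc_sum1 // mulr1.
by move=> x _; rewrite -mulr_sumr prodch_sum1 // mulr1.
Qed.

Lemma key_joint_total c s g : valid_code c -> \sum_k \sum_z key_joint c s g k z = 1.
Proof.
move=> vc; rewrite (eq_bigr (fun=> (cK c)%:R^-1)) => [|k _]; last exact: key_joint_row.
by rewrite sumr_const card_ord -[LHS]mulr_natr mulVf // pnatr_eq0 -lt0n; case: vc.
Qed.

Lemma key_joint_col c s g k z : valid_code c ->
  key_joint c s g k z <= \sum_k' key_joint c s g k' z.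
Proof.
by move=> vc; rewrite (bigD1 k) //= lerDl sumr_ge0 // => k' _; exact: key_joint_ge0.
Qed.

Lemma key_info_ge0 c s g : valid_code c -> 0 <= key_info c s g.
Proof.
move=> vc; have K0 : 0 < (cK c)%:R :> R by rewrite ltr0n; case: vc.
pose col z := \sum_k' key_joint c s g k' z.
suff : \sum_k \sum_z (key_joint c s g k z - col z / (cK c)%:R) / ln 2 <= key_info c s g.
  apply: le_trans; under eq_bigr do rewrite -mulr_suml.
  rewrite -mulr_suml mulr_ge0 ?invr_ge0 ?(ltW (ln2_gt0 R)) //.
  under eq_bigr do rewrite sumrB -mulr_suml.
  rewrite sumrB key_joint_total // sumr_const card_ord -[X in _ - X]mulr_natr divfK ?lt0r_neq0 //.
  by rewrite exchange_big key_joint_total // subrr.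
apply: ler_sum => k _; apply: ler_sum => z _.
case: ifPn => [p0|]; last first.
  rewrite -leNgt => p0; rewrite pmulr_lle0 ?invr_gt0 ?ln2_gt0 // subr_le0 (le_trans p0) //.
  by rewrite divr_ge0 ?(ltW K0) // sumr_ge0 // => k' _; exact: key_joint_ge0.
have c0 : 0 < col z := lt_le_trans p0 (key_joint_col s g k z vc).
rewrite /log2 mulrA ler_pM2r ?invr_gt0 ?ln2_gt0 //.
have := @mul_ln_div_ge R (key_joint c s g k z) (col z / (cK c)%:R) 1 p0.
rewrite divr_gt0 // ltr01 ln1 mulr0 add0r mul1r invf_div mulrA; exact.
Qed.

(** An entry never exceeds its column sum, so the argument of the logarithm is at most [K]. With
    [key_info_ge0] this gives the range needed for a Chernoff bound. *)
Lemma key_info_le c s g : valid_code c -> key_info c s g <= log2 (cK c)%:R.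
Proof.
move=> vc; have K0 : 0 < (cK c)%:R :> R by rewrite ltr0n; case: vc.
have lK0 : 0 <= log2 (cK c)%:R :> R.
  by rewrite divr_ge0 ?(ltW (ln2_gt0 R)) // ln_ge0 // ler1n; case: vc.
rewrite -[leRHS]mul1r -[X in _ <= X * _](key_joint_total s g vc) mulr_suml; apply: ler_sum => k _.
rewrite mulr_suml; apply: ler_sum => z _; case: ifPn => [p0|_].
  have c0 := lt_le_trans p0 (key_joint_col s g k z vc).
  apply: ler_wpM2l; first exact: ltW.
  rewrite ler_pM2r ?invr_gt0 ?ln2_gt0 // ler_ln ?posrE ?(divr_gt0 (mulr_gt0 p0 K0) c0) //.
  rewrite ler_pdivrMr // [leLHS]mulrC; apply: ler_wpM2l => //; exact: key_joint_col.
by rewrite mulr_ge0 // key_joint_ge0.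
Qed.

(** As an average over keys, the mean leakage can be estimated by sampling keys. *)
Lemma cleakE c s : valid_code c ->
  cleak V c s = (cG c)%:R^-1 * \sum_g key_info c s g.
Proof.
move=> vc; have K0 : 0 < (cK c)%:R :> R by rewrite ltr0n; case: vc.
have G0 : 0 < (cG c)%:R :> R by rewrite ltr0n; case: vc.
have jE g k z : joint V c s g k z = (cG c)%:R^-1 * key_joint c s g k z.
  by rewrite /joint /key_joint invfM mulrA [_^-1 * _^-1]mulrC.
rewrite /cleak /cmutinf mulr_sumr; apply: eq_bigr => g _.
rewrite mulr_sumr; apply: eq_bigr => k _; rewrite mulr_sumr; apply: eq_bigr => z _.
have -> : \sum_k' \sum_z' joint V c s g k' z' = (cG c)%:R^-1.
  under eq_bigr do under eq_bigr do rewrite jE.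
  by under eq_bigr do rewrite -mulr_sumr; rewrite -mulr_sumr key_joint_total // mulr1.
have -> : \sum_z' joint V c s g k z' = (cG c)%:R^-1 / (cK c)%:R.
  by under eq_bigr do rewrite jE; rewrite -mulr_sumr key_joint_row.
have -> : \sum_k' joint V c s g k' z = (cG c)%:R^-1 * \sum_k' key_joint c s g k' z.
  by under eq_bigr do rewrite jE; rewrite -mulr_sumr.
rewrite jE pmulr_rgt0 ?invr_gt0 //; case: ifPn => [p0|_]; last by rewrite mulr0.
have c0 := lt_le_trans p0 (key_joint_col s g k z vc).
rewrite -[LHS]mulrA; congr (_ * (_ * log2 _)).
by field; rewrite !lt0r_neq0.
Qed.

Lemma leak_cleak c s : valid_code c -> cG c = 1%N -> leak V c s = cleak V c s.
Proof.
move=> vc; have K0 : 0 < (cK c)%:R :> R by rewrite ltr0n; case: vc.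
rewrite cleakE // /leak; case: c vc K0 => K G e D vc /= K0 G1.
move: e D vc; rewrite {}G1 => e D vc; rewrite invr1 mul1r big_ord1.
have jE k z : \sum_(g < 1) joint V (Code e D) s g k z = key_joint (Code e D) s ord0 k z.
  by rewrite big_ord1 /joint /key_joint /= mulr1.
apply: eq_bigr => k _; apply: eq_bigr => z _; rewrite jE.
have -> : \sum_z' \sum_(g < 1) joint V (Code e D) s g k z' = K%:R^-1.
  by under eq_bigr do rewrite jE; rewrite (key_joint_row s (ord0 : 'I_(cG (Code e D))) k vc).
have -> : \sum_k' \sum_(g < 1) joint V (Code e D) s g k' z =
    \sum_k' key_joint (Code e D) s ord0 k' z by apply: eq_bigr => k' _; rewrite jE.
case: ifPn => // _; congr (_ * log2 _); by rewrite invfM invrK mulrA.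
Qed.

Lemma max_cleak_ge0 c : 0 <= max_cleak V c. Proof. exact: bigmax_ge_id. Qed.
Lemma max_leak_ge0 c : 0 <= max_leak V c. Proof. exact: bigmax_ge_id. Qed.

Definition rekey c L (h : 'I_L -> 'I_(cG c)) : Defs.code R X Y n :=
  @Code R X Y n (cK c) L (fun l => enc c (h l)) (fun l => dec c (h l)).

Lemma rekey_valid c L (h : 'I_L -> 'I_(cG c)) : (0 < L)%N -> valid_code c ->
  valid_code (rekey h).
Proof. by move=> L0 [K0 G0 e d]; split => // [l|l]; [exact: (e (h l))|exact: (d (h l))]. Qed.

(** Keys are drawn independently, with repetition. Information is divided by [B] to fit the unit
    interval, whence the loss [e * B]; the smallness condition makes the total failure probability
    less than 1. *)
Lemma key_reduction c (L : nat) (e B : R) : valid_code c -> (0 < L)%N ->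
  0 <= e <= 1 -> 0 < B -> log2 (cK c)%:R <= B ->
  2 * (#|S| ^ n)%:R * expR (- (e ^+ 2 / 8) * L%:R) < 1 ->
  exists h : 'I_L -> 'I_(cG c),
    avg_err W (rekey h) <= avg_err W c + e /\ max_cleak V (rekey h) <= max_cleak V c + e * B.
Proof.
move=> vc L0 e01 B0 KB small.
have K0 : 0 < (cK c)%:R :> R by rewrite ltr0n; case: vc.
have G0 : 0 < (cG c)%:R :> R by rewrite ltr0n; case: vc.
have L0R : 0 < L%:R :> R by rewrite ltr0n.
pose sg s g := (cK c)%:R^-1 * \sum_k key_succ W c s g k.
have succG s : succ W c s = (cG c)%:R^-1 * \sum_g sg s g.
  by rewrite succE invfM -mulr_sumr mulrA [_^-1 * _^-1]mulrC.
have sg01 s g : 0 <= sg s g <= 1.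
  rewrite mulr_ge0 ?invr_ge0 ?(ltW K0) ?sumr_ge0 //= => [|k _]; last exact: key_succ_ge0.
  rewrite /sg [leLHS]mulrC ler_pdivrMr // mul1r -[X in _ <= X%:R]card_ord -[leRHS]sumr_const.
  by apply: ler_sum => k _; exact: key_succ_le1.
have avg01 (f : 'I_(cG c) -> R) : (forall g, 0 <= f g <= 1) ->
    0 <= (cG c)%:R^-1 * \sum_g f g <= 1.
  move=> f01; rewrite mulr_ge0 ?invr_ge0 ?sumr_ge0 //= => [|g _]; last by case/andP: (f01 g).
  rewrite [leLHS]mulrC ler_pdivrMr // mul1r -[X in _ <= X%:R]card_ord -[leRHS]sumr_const.
  by apply: ler_sum => g _; case/andP: (f01 g).
pose inf s g := key_info c s g / B.
have inf01 s g : 0 <= inf s g <= 1.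
  rewrite divr_ge0 ?key_info_ge0 ?(ltW B0) //= ler_pdivrMr // mul1r.
  by apply: le_trans KB; exact: key_info_le.
have conc (f : 'I_(cG c) -> R) : (forall g, 0 <= f g <= 1) ->
    \sum_(h : {ffun 'I_L -> 'I_(cG c)} |
        e * L%:R <= \sum_(l < L) (f (h l) - (cG c)%:R^-1 * \sum_g f g))
      \prod_(l < L) (cG c)%:R^-1 <= expR (- (e ^+ 2 / 8) * L%:R).
  move=> f01; apply: (@chernoff_ffun R 'I_(cG c) L (fun _ _ => (cG c)%:R^-1)
    (fun _ g => f g - (cG c)%:R^-1 * \sum_g f g) e) => //.
  - by move=> _; rewrite sumr_const card_ord -[LHS]mulr_natr mulVf // lt0r_neq0.
  - move=> _; rewrite -mulr_sumr sumrB sumr_const card_ord -[X in _ - X]mulr_natl.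
    by rewrite mulrA divff ?lt0r_neq0 // mul1r subrr mulr0.
  - move=> _ g; have /andP[a0 a1] := avg01 f f01; have /andP[f0 f1] := f01 g.
    by rewrite ler_norml; apply/andP; split; lra.
(* Stated for the error [1 - sg], since the Chernoff bound controls upward deviations. *)
pose bad1 (h : {ffun 'I_L -> 'I_(cG c)}) s := e * L%:R <=
  \sum_(l < L) ((1 - sg s (h l)) - (cG c)%:R^-1 * \sum_g (1 - sg s g)).
pose bad2 (h : {ffun 'I_L -> 'I_(cG c)}) s := e * L%:R <=
  \sum_(l < L) (inf s (h l) - (cG c)%:R^-1 * \sum_g inf s g).
have [h hgood] : exists h, forall s, ~~ bad1 h s /\ ~~ bad2 h s.
  apply: contrapT => none; move: small; apply/negP; rewrite -leNgt.
  pose w : R := \prod_(l < L) (cG c)%:R^-1.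
  have w0 : 0 <= w by apply: prodr_ge0 => l _; rewrite invr_ge0.
  have w1 : \sum_(h : {ffun 'I_L -> 'I_(cG c)}) w = 1.
    rewrite sumr_const card_ffun !card_ord /w prodr_const card_ord -[LHS]mulr_natr natrX.
    by rewrite -exprMn mulVf ?expr1n // lt0r_neq0.
  rewrite -[leLHS]w1.
  apply: (@le_trans _ _ (\sum_s (\sum_(h | bad1 h s) w + \sum_(h | bad2 h s) w))).
    rewrite big_split /=; under [X in _ <= X + _]eq_bigr do rewrite big_mkcond /=.
    under [X in _ <= _ + X]eq_bigr do rewrite big_mkcond /=.
    rewrite [X in _ <= X + _]exchange_big [X in _ <= _ + X]exchange_big -big_split /=; apply: ler_sum => h _.
    have [s bs] : exists s, bad1 h s || bad2 h s.
      apply: contrapT => /forallNP nb; apply: none; exists h => s.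
      by have /negP := nb s; rewrite negb_or => /andP[].
    have pos (b : {ffun 'I_n -> S} -> bool) (P : pred {ffun 'I_n -> S}) :
      0 <= \sum_(s | P s) (if b s then w else 0) by apply: sumr_ge0 => s' _; case: ifP.
    case/orP: bs => bs.
      by rewrite (bigD1 s) //= bs -addrA lerDl addr_ge0 // pos.
    by rewrite [X in _ + X](bigD1 s) //= bs addrCA lerDl addr_ge0 // pos.
  apply: (@le_trans _ _ (\sum_(s : {ffun 'I_n -> S}) 2 * expR (- (e ^+ 2 / 8) * L%:R))).
    apply: ler_sum => s _; rewrite mulr_natl mulr2n; apply: lerD; apply: conc => g //.
    by have /andP[] := sg01 s g => a b; apply/andP; split; lra.
  by rewrite sumr_const card_ffun card_ord -[leLHS]mulr_natr mulrAC.
exists h; split.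
  apply: avg_err_le => [|s]; first by rewrite addr_ge0 ?avg_err_ge0 //; case/andP: e01.
  have [b1 _] := hgood s; move: b1; rewrite /bad1 -ltNge sumrB sumr_const card_ord.
  have E : (cG c)%:R^-1 * (\sum_g (1 - sg s g)) = 1 - succ W c s.
    by rewrite sumrB sumr_const card_ord mulrBr mulVf ?lt0r_neq0 // -succG.
  have E' : succ W (rekey h) s = L%:R^-1 * \sum_(l < L) sg s (h l).
    by rewrite succE /= invfM -mulr_sumr mulrA [_^-1 * _^-1]mulrC.
  rewrite E sumrB sumr_const card_ord -[(1 - succ W c s) *+ L]mulr_natr => b1.
  have := avg_err_succ W c s => b2.
  have : (1 - (avg_err W c + e)) * L%:R <= \sum_(l < L) sg s (h l).
    have := ler_wpM2r (ltW L0R) b2; lra.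
  by move=> b3; rewrite E' [leRHS]mulrC ler_pdivlMr.
apply: bigmax_le => [|s _]; first by rewrite addr_ge0 ?max_cleak_ge0 // mulr_ge0 ?(ltW B0) //; case/andP: e01.
have [_ b2] := hgood s; move: b2; rewrite /bad2 -ltNge sumrB sumr_const card_ord.
have E : (cG c)%:R^-1 * (\sum_g inf s g) = cleak V c s / B by rewrite cleakE // -mulr_suml mulrA.
have E' : cleak V (rekey h) s = L%:R^-1 * \sum_(l < L) inf s (h l) * B.
  rewrite cleakE; last exact: rekey_valid.
  congr (_ * _); apply: eq_bigr => l _; rewrite /inf divfK ?lt0r_neq0 //.
rewrite E ltrBlDr -[X in _ < _ + X]mulr_natr -mulrDl -(ltr_pM2r B0) => b2.
rewrite E' -mulr_suml [leLHS]mulrC ler_pdivrMr //.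
have b3 : cleak V c s <= max_cleak V c by exact: (le_bigmax _ _ s).
apply: le_trans (ltW b2) _; rewrite mulrAC ler_pM2r // mulrDl divfK ?lt0r_neq0 //.
by rewrite addrC lerD2r.
Qed.

End KeyReduction.

(** * Assembling sequences of uncorrelated codes *)

Section Assembly.
Local Open Scope classical_set_scope.
Variables (R : realType) (X Y Z S : finType).
Variables (W : S -> X -> Y -> R) (V : S -> X -> Z -> R).
Hypotheses (hW : forall s, is_channel (W s)) (hV : forall s, is_channel (V s)).

Definition constant_code (x0 : X) n K (D : 'I_K -> {set {ffun 'I_n -> Y}}) : Defs.code R X Y n :=
  @Code R X Y n K 1 (fun _ _ x => (x == [ffun=> x0])%:R) (fun _ => D).

Lemma constant_code_valid x0 n K (D : 'I_K -> {set {ffun 'I_n -> Y}}) : (0 < K)%N ->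
  (forall k k', k != k' -> [disjoint D k & D k']%B) -> valid_code (constant_code x0 D).
Proof.
move=> K0 dis; split => // g k _.
split => [x|] //=; rewrite (bigD1 [ffun=> x0]) //= eqxx big1 ?addr0 //.
by move=> x /negbTE ->.
Qed.

Lemma limn_esup_eq0P (v : nat -> R) : (forall n, 0 <= v n) ->
  limn_esup (fun n => (v n)%:E) = 0%E <->
  forall d : R, 0 < d -> \forall n \near \oo, v n <= d.
Proof.
move=> v0; split => [v_0 d d0|vd].
  have := @limn_esup_lt_near R (fun n => (v n)%:E) d%:E.
  by rewrite v_0 lte_fin => /(_ d0); apply: filterS => n; rewrite lee_fin.
apply/eqP; rewrite eq_le; apply/andP; split.
  apply/lee_addgt0Pr => d d0; rewrite add0e; apply: near_limn_esup_le.
  by apply: filterS (vd d d0) => n; rewrite lee_fin.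
apply: le_trans (limn_einf_sup _); apply: near_limn_einf_ge.
by apply: nearW => n; rewrite lee_fin.
Qed.

Lemma cvg_to0P (v : nat -> R) : (forall n, 0 <= v n) ->
  v @ \oo --> (0 : R) <-> forall d : R, 0 < d -> \forall n \near \oo, v n <= d.
Proof.
move=> v0; split => [/cvgr0Pnorm_le v_0 d d0|vd].
  by apply: filterS (v_0 d d0) => n; rewrite ger0_norm.
apply/cvgr0Pnorm_le => d d0; apply: filterS (vd d d0) => n; by rewrite ger0_norm.
Qed.

(** At length [n], an object is chosen that meets every attainable tolerance [1 / (k + 1)] with
    [k < n]; for fixed [d] some such tolerance lies below [d] and is eventually attainable. *)
Lemma diagonal_choice (T : nat -> Type) (base : forall n, T n -> Prop)
    (good : forall n, R -> T n -> Prop) :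
  (forall n, exists c, base n c) ->
  (forall n d d' c, d <= d' -> good n d c -> good n d' c) ->
  (forall d : R, 0 < d -> \forall n \near \oo, exists2 c, base n c & good n d c) ->
  exists c : forall n, T n, (forall n, base n (c n)) /\
    forall d : R, 0 < d -> \forall n \near \oo, good n d (c n).
Proof.
move=> exb mono exg.
have best n K : exists c, base n c /\ forall k, (k < K)%N ->
    (exists2 c', base n c' & good n k.+1%:R^-1 c') -> good n k.+1%:R^-1 c.
  elim: K => [|K [c [bc IH]]]; first by have [c bc] := exb n; exists c.
  have [[c' bc' gc']|none] := pselect (exists2 c', base n c' & good n K.+1%:R^-1 c').
    exists c'; split => // k kK _; apply: mono gc'.
    by rewrite lef_pV2 ?posrE // ler_nat.
  exists c; split => // k; rewrite ltnS leq_eqVlt => /orP[/eqP -> //|]; exact: IH.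
pose c n := projT1 (cid (best n n)).
have cP n := projT2 (cid (best n n)).
exists c; split => [n|d d0]; first by case: (cP n).
have [k kd] : exists k, k.+1%:R^-1 <= d.
  exists (Num.bound d^-1); rewrite invf_ple ?posrE // ltW //.
  apply: lt_trans (archi_boundP _) _; first by rewrite invr_ge0 ltW.
  by rewrite ltr_nat.
near=> n; apply: mono kd _; apply: (cP n).2; first by near: n; exact: nbhs_infty_gt.
by near: n; apply: exg; rewrite invr_gt0.
Unshelve. all: by end_near. Qed.

Lemma log2_messages_le n (c : Defs.code R X Y n) (s0 : S) (x0 : X) : (0 < n)%N ->
  valid_code c -> avg_err W c <= 1 / 2 ->
  log2 (cK c)%:R <= n%:R * (1 + log2 #|Y|%:R) :> R.
Proof.
move=> n0 vc ce; have := messages_le hW s0 vc ce; case: vc => K0 _ _ _ KY.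
have Y0 : (0 < #|Y|)%N.
  rewrite lt0n; apply/eqP => Y0; have := (hW s0 x0).2; rewrite big1 => [/eqP|y _].
    by rewrite eq_sym oner_eq0.
  by have := card0_eq Y0 y; rewrite inE.
have K0R : 0 < (cK c)%:R :> R by rewrite ltr0n.
have Y0R : 0 < #|Y|%:R :> R by rewrite ltr0n.
rewrite ler_pdivrMr ?ln2_gt0 // -mulrA mulrDl divfK ?lt0r_neq0 ?ln2_gt0 // mul1r.
have : ln (cK c)%:R <= ln (2 * (#|Y| ^ n)%:R) :> R.
  by rewrite ler_ln ?posrE // mulr_gt0 // ltr0n expn_gt0 Y0.
move=> /le_trans; apply; rewrite lnM ?posrE ?ltr0n ?expn_gt0 ?Y0 //.
rewrite natrX lnXn // mulrDr -[ln _ *+ n]mulr_natl lerD2r ler_peMl ?ler1n //.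
exact: ltW (ln2_gt0 R).
Qed.

Lemma rate_bounded (s0 : S) (x0 : X) (c : forall n, Defs.code R X Y n) :
  (forall n, valid_code (c n)) -> err_vanishes W c ->
  \forall n \near \oo, rate (c n) <= 1 + log2 #|Y|%:R.
Proof.
move=> vc /(cvg_to0P (fun n => avg_err_ge0 W (c n))) err; near=> n.
have n0 : (0 < n)%N by near: n; exact: nbhs_infty_gt.
rewrite ler_pdivrMr ?ltr0n // mulrC; apply: (log2_messages_le s0 x0) => //.
by near: n; apply: err.
Unshelve. all: by end_near. Qed.

(** With deviation [et / (n b)] the exponent is at least a multiple of [n ^ 2], against [n ln #|S|]
    from the union bound. *)
Lemma key_size_suffices (b et : R) : 0 < b -> 0 < et ->
  \forall n \near \oo, forall L, (n ^ 4 <= L)%N ->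
    2 * (#|S| ^ n)%:R * expR (- ((et / (n%:R * b)) ^+ 2 / 8) * L%:R) < 1.
Proof.
move=> b0 et0; pose ka := et ^+ 2 / (8 * b ^+ 2).
have ka0 : 0 < ka by rewrite divr_gt0 ?mulr_gt0 ?exprn_gt0.
pose a : R := ln #|S|.+1%:R + 1.
near=> n => L nL.
have n0 : (0 < n)%N by near: n; exact: nbhs_infty_gt.
have n0R : 0 < n%:R :> R by rewrite ltr0n.
have ek : ka * n%:R ^+ 2 <= (et / (n%:R * b)) ^+ 2 / 8 * L%:R.
  have : n%:R ^+ 4 <= L%:R :> R by rewrite -natrX ler_nat.
  have p0 : 0 <= (et / (n%:R * b)) ^+ 2 / 8 by rewrite divr_ge0 // sqr_ge0.
  move=> /(ler_wpM2l p0); apply: le_trans; rewrite le_eqVlt; apply/orP; left; apply/eqP.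
  by rewrite /ka; field; rewrite !lt0r_neq0.
have nk : a < ka * n%:R.
  rewrite mulrC -ltr_pdivrMr //; near: n; exact: nbhs_infty_gtr.
have S1 : (#|S| ^ n)%:R <= expR (n%:R * ln #|S|.+1%:R) :> R.
  by rewrite expRM_natl lnK ?posrE // -natrX ler_nat leq_exp2r.
have e2 : 2 <= expR n%:R :> R.
  apply: le_trans (expR_ge1Dx _); rewrite (natrD R 1 1) lerD2l ler1n //.
apply: (@le_lt_trans _ _ (expR n%:R * expR (n%:R * ln #|S|.+1%:R) * expR (- (ka * n%:R ^+ 2)))).
  apply: ler_pM; rewrite ?mulr_ge0 ?expR_ge0 //; first by apply: ler_pM.
  by rewrite ler_expR mulNr lerN2.
rewrite -!expRD -[ltRHS]expR0 ltr_expR.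
have : n%:R * a < n%:R * (ka * n%:R) by rewrite ltr_pM2l.
by rewrite /a; nra.
Unshelve. all: by end_near. Qed.

Lemma derandomized_codes (x0 : X) (s0 : S) (c : forall n, Defs.code R X Y n) (t d : R) (p : nat) :
  ~ symmetrizable W -> (forall n, valid_code (c n)) ->
  (forall d : R, 0 < d -> \forall n \near \oo, avg_err W (c n) <= d) ->
  (forall d : R, 0 < d -> \forall n \near \oo, max_cleak V (c n) <= d) ->
  (\forall n \near \oo, t <= rate (c n)) -> 0 <= t -> (1 < p)%N -> 0 < d ->
  \forall N \near \oo, exists2 c' : Defs.code R X Y N, valid_code c' /\ cG c' = 1%N &
    [/\ avg_err W c' <= d, max_leak V c' <= d & t * (1 - p%:R^-1) <= rate c'].
Proof.
move=> nsym vc err leak tr t0 p1 d0.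
pose b : R := 1 + log2 #|Y|%:R.
(* Prefix, original code and key reduction each add at most [d / 4] to the error; the last two do so
   for the leakage. *)
pose et : R := Num.min 1 (d / 4).
have d4 : 0 < d / 4 by rewrite divr_gt0.
have et0 : 0 < et by rewrite lt_min ltr01.
have et1 : et <= 1 by rewrite ge_min lexx.
have etd : et <= d / 4 by rewrite ge_min lexx orbT.
have b1 : 1 <= b.
  rewrite lerDl divr_ge0 ?(ltW (ln2_gt0 R)) //.
  have [->|Y0] := posnP #|Y|; first by rewrite ln0.
  by rewrite ln_ge0 // ler1n.
have b0 : 0 < b := lt_le_trans ltr01 b1.
have p0R : 0 < p%:R :> R by rewrite ltr0n ltnW.
have [n0 _ Hn] : \forall n \near \oo, [/\ (0 < n)%N, avg_err W (c n) <= d / 4,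
    avg_err W (c n) <= 1 / 2, max_cleak V (c n) <= d / 4 & t <= rate (c n)] /\
    forall L, (n ^ 4 <= L)%N ->
    2 * (#|S| ^ n)%:R * expR (- ((et / (n%:R * b)) ^+ 2 / 8) * L%:R) < 1.
  near=> n; split; last by near: n; exact: key_size_suffices.
  by split; near: n; [exact: nbhs_infty_gt|exact: err|apply: err|exact: leak|exact: tr].
(* [(2 * p) ^ 4 < m] together with [N <= 2 * p * m] yields [N ^ 4 <= m ^ 5]. *)
have [m0 _ Hm] : \forall m \near \oo, ((2 * p) ^ 4 < m)%N /\ forall L, (m <= L <= m ^ 5)%N ->
    exists (pre : 'I_L -> {ffun 'I_m -> X}) (D : 'I_L -> {set {ffun 'I_m -> Y}}),
      (forall i j, i != j -> [disjoint D i & D j]%B) /\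
      forall s : {ffun 'I_m -> S},
        (1 - d / 4) * L%:R <= \sum_(i < L) \sum_(y in D i) prodch W s (pre i) y.
  near=> m; split; first by near: m; exact: nbhs_infty_gt.
  by near: m; exact: small_code.
(* As [p >= 2], the prefix takes at most half of [N], so [n >= n0]; and [N >= p * m0] gives
   [m >= m0]. *)
exists (maxn (2 * n0) (p * m0)) => // N /=; rewrite geq_max => /andP[Nn Nm].
pose m := (N %/ p)%N; pose n := (N - m)%N.
have mN : (m * p <= N)%N by exact: leq_trunc_div.
have Np : (N < m.+1 * p)%N by exact: ltn_ceil (ltnW p1).
have m2 : (m * 2 <= N)%N by apply: leq_trans mN; rewrite leq_mul2l p1 orbT.
have nn0 : (n0 <= n)%N by rewrite /n; clear -Nn m2; lia.
have mm0 : (m0 <= m)%N by rewrite leq_divRL ?(ltnW p1) // mulnC.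
have NE : N = (m + n)%N by rewrite /n; clear -m2; lia.
have [[n_gt0 e1 e2 l1 r1] Hkey] := Hn n nn0.
have [mp HL] := Hm m mm0.
pose L := (N ^ 4)%N.
have N0 : (0 < N)%N by rewrite NE addn_gt0 n_gt0 orbT.
have mL : (m <= L <= m ^ 5)%N.
  apply/andP; split.
    apply: (@leq_trans N); first by rewrite NE leq_addr.
    by rewrite -[X in (X <= _)%N]expn1 leq_pexp2l.
  have : (N <= 2 * p * m)%N.
    apply: leq_trans (ltnW Np) _; rewrite mulnAC leq_mul2r mul2n -addnn -addn1 leq_add2l.
    by rewrite (leq_ltn_trans _ mp) ?orbT.
  rewrite -(leq_exp2r _ _ (isT : 0 < 4)%N) => /leq_trans; apply.
  by rewrite expnMn expnS leq_mul2r ltnW ?orbT.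
have L0 : (0 < L)%N by rewrite expn_gt0 N0.
have nb1 : 1 <= n%:R * b by rewrite -[leLHS]mulr1 ler_pM // ler1n.
have nb0 : 0 < n%:R * b := lt_le_trans ltr01 nb1.
pose e := et / (n%:R * b).
have e_et : e <= et by rewrite ler_pdivrMr // ler_peMr // ltW.
have e01 : 0 <= e <= 1 by rewrite divr_ge0 ?(ltW et0) ?(ltW nb0) //= (le_trans e_et).
have nL : (n ^ 4 <= L)%N by rewrite leq_exp2r // leq_subr.
have KB := log2_messages_le s0 x0 n_gt0 (vc n) e2.
have [h [herr hleak]] := key_reduction hW hV (vc n) L0 e01 nb0 KB (Hkey L nL).
have [pre [D [disD hD]]] := HL L mL.
have vr := rekey_valid h L0 (vc n).
rewrite NE; exists (@prefixed R X Y m n (rekey h) pre D).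
  by split => //; exact: prefixed_valid.
split.
- apply: le_trans (prefixed_err vr hW (ltW d4) hD) _; lra.
- apply: le_trans (prefixed_leak _ _ vr hV) _; apply: le_trans hleak _.
  by rewrite divfK ?lt0r_neq0 //; lra.
rewrite /rate /=; have n0R : 0 < n%:R :> R by rewrite ltr0n.
have N0R : 0 < (m + n)%:R :> R by rewrite ltr0n -NE.
rewrite ler_pdivlMr //; move: r1; rewrite /rate ler_pdivlMr // => r1; apply: le_trans r1.
rewrite -mulrA; apply: ler_wpM2l => //; rewrite mulrBl mul1r lerBlDr natrD addrC lerD2l.
by rewrite mulrC ler_pdivlMr // -natrD -natrM ler_nat addnC -NE.
Unshelve. all: by end_near. Qed.

(** The exact lower limit of the new rates is not controlled, only that it is at least
    [t (1 - 1/p)]; this can be brought as close to [r] as desired. *)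
Lemma derandomization (x0 : X) (s0 : S) (r : R) : ~ symmetrizable W ->
  achievable_Sran_mean W V r -> forall (t : R) (p : nat), 0 <= t -> t < r -> (1 < p)%N ->
  exists2 r', achievable_S W V r' & t * (1 - p%:R^-1) <= r'.
Proof.
move=> nsym [c [vc /(cvg_to0P (fun n => avg_err_ge0 W (c n))) err rr]].
move=> /(limn_esup_eq0P (fun n => max_cleak_ge0 V (c n))) leak t p t0 tr p1.
have tn : \forall n \near \oo, t <= rate (c n).
  have := @limn_einf_gt_near R (fun n => (rate (c n))%:E) t%:E.
  by rewrite rr lte_fin => /(_ tr); apply: filterS => n; rewrite lee_fin.
have [|||c' [base good]] := @diagonal_choice (Defs.code R X Y)
  (fun n c' => valid_code c' /\ cG c' = 1%N)
  (fun n d c' => [/\ avg_err W c' <= d, max_leak V c' <= d & t * (1 - p%:R^-1) <= rate c']).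
- move=> n; exists (constant_code x0 (fun _ : 'I_1 => finset.setT)); split => //.
  by apply: constant_code_valid => // k k'; rewrite !ord1 eqxx.
- by move=> n d d' c' dd' [h1 h2 h3]; split => //; exact: le_trans dd'.
- move=> d d0; exact: (derandomized_codes x0 s0 nsym vc err leak tn t0 p1 d0).
have vc' n : valid_code (c' n) by have [] := base n.
have err' : err_vanishes W c'.
  apply/(cvg_to0P (fun n => avg_err_ge0 W (c' n))) => d d0.
  by apply: filterS (good d d0) => n [].
(* The rate clause does not depend on the tolerance, so tolerance 1 supplies it. *)
have [r' r'E tr'] := @limn_einf_fin R (fun n => rate (c' n)) (t * (1 - p%:R^-1)) _
  (filterS (fun n (H : [/\ _, _ & _]) => let: And3 _ _ h := H in h) (good 1 ltr01))
  (rate_bounded s0 x0 vc' err').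
exists r' => //; exists c'; split => //; first by move=> n; have [] := base n.
apply/(limn_esup_eq0P (fun n => max_leak_ge0 V (c' n))) => d d0.
by apply: filterS (good d d0) => n [].
Qed.

End Assembly.

(** * Comparison of the capacities and degenerate alphabets *)

Section Capacities.
Local Open Scope classical_set_scope.
Variables (R : realType) (X Y Z S : finType).
Variables (W : S -> X -> Y -> R) (V : S -> X -> Z -> R).
Hypotheses (hW : forall s, is_channel (W s)) (hV : forall s, is_channel (V s)).

Lemma valid_code_input n (c : Defs.code R X Y n) : (0 < n)%N -> valid_code c -> (0 < #|X|)%N.
Proof.
move=> n0 vc; case: (vc) => K0 G0 _ _; rewrite lt0n; apply/eqP => X0.
have := valid_enc_sum1 (Ordinal G0) (Ordinal K0) vc; rewrite big1 => [/eqP|x _].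
  by rewrite eq_sym oner_eq0.
by have := card0_eq X0 (x (Ordinal n0)); rewrite inE.
Qed.

Lemma symmetrizable_rate0 (r : R) : symmetrizable W -> achievable_S W V r -> r = 0.
Proof.
move=> symW [c [vc G1 /(cvg_to0P (fun n => avg_err_ge0 W (c n))) err rr _]].
have K1 : \forall n \near \oo, rate (c n) = 0.
  have : \forall n \near \oo, avg_err W (c n) <= 1 / 8 by apply: err; rewrite divr_gt0.
  apply: filterS => n en; have K1 : cK (c n) = 1%N.
    by apply: symmetrizable_one_message => //; lra.
  by rewrite /rate K1 /log2 ln1 !mul0r.
apply/eqP; rewrite eq_le -!lee_fin -rr; apply/andP; split.
  by apply: near_limn_einf_le; apply: filterS K1 => n ->.
by apply: near_limn_einf_ge; apply: filterS K1 => n ->.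
Qed.

Lemma achievable_S_ran (r : R) : achievable_S W V r -> achievable_Sran_mean W V r.
Proof.
move=> [c [vc G1 err rr leak]]; exists c; split => //; rewrite -leak; congr limn_esup.
apply/funext => n; congr (_%:E); apply: eq_bigr => s _; rewrite leak_cleak //.
Qed.

(** For [n > 0] there are no state sequences, so error and maximal leakage take the default value 0;
    it suffices to keep the number of messages. *)
Lemma achievable_ran_stateless (x0 : X) (r : R) : #|S| = 0%N ->
  achievable_Sran_mean W V r -> achievable_S W V r.
Proof.
move=> S0 [c [vc err rr leak]].
have noS n : (0 < n)%N -> {ffun 'I_n -> S} -> False.
  by move=> n0 s; have := card0_eq S0 (s (Ordinal n0)); rewrite inE.
pose c' n : Defs.code R X Y n :=
  constant_code R x0 (fun _ : 'I_(cK (c n)) => finset.set0).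
exists c'; split => //.
- move=> n; have [K0 _ _ _] := vc n; apply: constant_code_valid => // k k' _.
  by rewrite finset.disjoints_subset finset.sub0set.
- apply/(cvg_to0P (fun n => avg_err_ge0 W (c' n))) => d d0.
  exists 1%N => // n /= n0; apply: avg_err_le => [|s]; [exact: ltW|by case: (noS n)].
- apply/(limn_esup_eq0P (fun n => max_leak_ge0 V (c' n))) => d d0.
  by exists 1%N => // n /= n0; apply: bigmax_le => [|s _]; [exact: ltW|case: (noS n)].
Qed.

(** One message, always decoded, leaks at most [log 1 = 0]. It makes both sets of rates nonempty. *)
Lemma achievable_S0 (x0 : X) : achievable_S W V 0.
Proof.
pose c n : Defs.code R X Y n := constant_code R x0 (fun _ : 'I_1 => finset.setT).
have vc n : valid_code (c n) by apply: constant_code_valid => // k k'; rewrite !ord1 eqxx.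
have rate0 n : rate (c n) = 0 by rewrite /rate /log2 ln1 !mul0r.
exists c; split => //.
- apply/(cvg_to0P (fun n => avg_err_ge0 W (c n))) => d d0; apply: nearW => n.
  apply: le_trans (ltW d0); apply: avg_err_le => // s.
  rewrite succE /= !big_ord1 mulr1 invr1 mul1r subr0 -[leLHS](@valid_enc_sum1 R X Y n (c n) ord0 ord0 (vc n)).
  apply: ler_sum => x _; rewrite -[leLHS]mulr1 ler_wpM2l ?valid_enc_ge0 //.
  rewrite -[leLHS](prodch_sum1 hW s x) le_eqVlt; apply/orP; left; apply/eqP.
  by apply: eq_bigl => y; rewrite inE.
- under eq_fun do rewrite rate0; apply/eqP; rewrite eq_le; apply/andP; split.
    by apply: near_limn_einf_le; apply: nearW.
  by apply: near_limn_einf_ge; apply: nearW.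
- apply/(limn_esup_eq0P (fun n => max_leak_ge0 V (c n))) => d d0; apply: nearW => n.
  apply: le_trans (ltW d0); apply: bigmax_le => // s _.
  rewrite leak_cleak // cleakE //= invr1 mul1r big_ord1.
  by apply: le_trans (key_info_le hV s _ (vc n)) _; rewrite /log2 ln1 mul0r.
Qed.

Lemma achievable_ran_le (x0 : X) (s0 : S) (r : R) : achievable_Sran_mean W V r ->
  r <= 1 + log2 #|Y|%:R.
Proof.
move=> [c [vc err rr _]]; rewrite -lee_fin -rr; apply: near_limn_einf_le.
by apply: filterS (rate_bounded hW s0 x0 vc err) => n; rewrite lee_fin.
Qed.

End Capacities.

Theorem theorem2 (R : realType) (X Y Z S : finType)
  (W : S -> X -> Y -> R) (V : S -> X -> Z -> R)
  (hW : forall s, is_channel (W s)) (hV : forall s, is_channel (V s)) :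
  (symmetrizable W -> C_S W V = 0) /\
  (~ symmetrizable W -> C_S W V = C_Sran_mean W V).
Proof.
split => [symW|nsym]; rewrite /C_S /C_Sran_mean.
  set A := (X in sup X).
  have A0 : (A `<=` [set 0])%classic by move=> r Ar; exact: (symmetrizable_rate0 hW symW Ar).
  (* [sup] is 0 on the empty set by convention and on the singleton of 0. *)
  have [[r Ar]|/forallNP none] := pselect (exists r, A r).
    suff -> : A = [set 0]%classic by exact: sup1.
    apply/seteqP; split => // _ ->; by rewrite -(A0 r Ar).
  suff -> : A = set0 by exact: sup0.
  by apply/seteqP; split => // r /none.
have [X0|/card_gt0P[x0 _]] := posnP #|X|.
  (* Without input letters no valid code of length one exists, so both sets of rates are empty. *)
  congr sup; apply/seteqP; split => r [c []]; [move=> vc _|move=> vc] => _ _ _;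
    by have := valid_code_input (ltn0Sn 0) (vc 1%N); rewrite X0.
have [S0|/card_gt0P[s0 _]] := posnP #|S|.
  congr sup; apply/seteqP; split => r /=; first exact: achievable_S_ran.
  exact: achievable_ran_stateless.
have ub : ubound [set r | achievable_Sran_mean W V r]%classic (1 + log2 #|Y|%:R).
  by move=> r; exact: (achievable_ran_le hW x0 s0).
have ub' : has_ubound [set r | achievable_S W V r]%classic.
  by exists (1 + log2 #|Y|%:R) => r /(achievable_S_ran hV) /ub.
have r0A := achievable_S0 hW hV x0.
apply/eqP; rewrite eq_le; apply/andP; split.
  apply: ge_sup; first by exists 0.
  move=> r /(achievable_S_ran hV) rA; apply: ub_le_sup => //; by exists (1 + log2 #|Y|%:R).
apply: ge_sup; first by exists 0; exact: achievable_S_ran.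
move=> r rA; set C := sup _.
have C0 : 0 <= C by exact: ub_le_sup.
apply/ler_addgt0Pr => e e0.
have [rs|rl] := lerP r (e / 2); first by lra.
(* Half of [e] is lost in passing from [r] to [t], the other half to the prefix, as
   [t / p <= e / 2]. *)
pose t := r - e / 2.
have t0 : 0 <= t by rewrite /t; lra.
have tr : t < r by rewrite /t; lra.
pose p := (Num.bound (t / (e / 2))).+2.
have p0 : 0 < p%:R :> R by rewrite ltr0n.
have tp : t / p%:R <= e / 2.
  rewrite ler_pdivrMr // mulrC -ler_pdivrMr ?divr_gt0 // ltW //.
  apply: lt_le_trans (archi_boundP _) _; first by rewrite divr_ge0 // divr_ge0 // ltW.
  by rewrite ler_nat leqW.
have [r' r'A tr'] := derandomization hW hV x0 s0 nsym rA t0 tr (isT : (1 < p)%N).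
have : r' <= C by exact: ub_le_sup.
by move: tr'; rewrite mulrBr mulr1 /t in tp *; lra.
Qed.
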